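(* Let $K$ be a field and let $\mathcal{P}$ be a simple thin polyomino such that the reduced Hilbert–Poincaré series of $K[\mathcal{P}]$ is $$\mathrm{HP}_{K[\mathcal{P}]}(t)=\frac{h(t)}{(1-t)^d}.$$ Then $h(t)$ is the rook polynomial of $\mathcal{P}$, i.e. $h(t)=r_{\mathcal{P}}(t)$.
   Context: Polyominoes. A cell is a unit square $C=[a,a+(1,1)]$ with $a\in\mathbb{N}^2$; its vertex set is $V(C)=\{a,a+(1,0),a+(0,1),a+(1,1)\}$, and its edges are its four sides. A polyomino $\mathcal{P}$ is a finite nonempty collection of cells such that any two cells $C,D\in\mathcal{P}$ are connected by a sequence of cells $C=C_1,\dots,C_m=D$ of $\mathcal{P}$ with $C_i\cap C_{i+1}$ an edge of $C_i$ for each $i<m$. Put $V(\mathcal{P})=\bigcup_{C\in\mathcal{P}}V(C)$. $\mathcal{P}$ is simple if any two cells of $\mathbb{N}^2$ not in $\mathcal{P}$ can be connected by such an edge-to-edge sequence of cells of $\mathbb{N}^2$ none of which is in $\mathcal{P}$. $\mathcal{P}$ is thin if it does not contain a square tetromino, i.e. there is no $2\times 2$ block of four cells all belonging to $\mathcal{P}$. The algebra $K[\mathcal{P}]$. For $a=(i,j)$, $b=(k,\ell)$ in $\mathbb{N}^2$ with $i<k$, $j<\ell$, the interval $[a,b]=\{(r,s)\in\mathbb{N}^2: i\le r\le k,\ j\le s\le \ell\}$ is called an inner interval of $\mathcal{P}$ if all the cells contained in the rectangle $[a,b]$ belong to $\mathcal{P}$. Let $R=K[x_v\mid v\in V(\mathcal{P})]$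 be the standard graded polynomial ring. The polyomino ideal $I_{\mathcal{P}}\subset R$ is generated by all binomials $x_ax_b-x_cx_d$ where $[a,b]$ is an inner interval of $\mathcal{P}$, $c=(i,\ell)$ and $d=(k,j)$. Put $K[\mathcal{P}]=R/I_{\mathcal{P}}$. Hilbert series. $\mathrm{HP}_{K[\mathcal{P}]}(t)=\sum_{k\ge 0}\dim_K (K[\mathcal{P}])_k\,t^k$. By the Hilbert–Serre theorem it is a rational function; its reduced form is $h(t)/(1-t)^d$ with $h(t)\in\mathbb{Z}[t]$, $h(1)\neq 0$, and $d$ the Krull dimension of $K[\mathcal{P}]$. Rook polynomial. Two rooks placed on distinct cells of $\mathcal{P}$ attack each other if their cells lie in the same row or in the same column and all the cells between them belong to $\mathcal{P}$. Let $r_k$ be the number of sets of $k$ pairwise non-attacking rooks on the cells of $\mathcal{P}$ ($r_0=1$), and let the rook number $r(\mathcal{P})$ be the maximal $k$ with $r_k\ne 0$. The rook polynomial is $r_{\mathcal{P}}(t)=\sum_{k=0}^{r(\mathcal{P})}r_kt^k$. *)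

(* Defs.v *)
From HB Require Import structures.
From mathcomp Require Import all_boot all_order all_algebra.
From mathcomp Require Import finmap boolp mpoly.

Set Implicit Arguments.
Unset Strict Implicit.
Unset Printing Implicit Defensive.

Import GRing.Theory.
Local Open Scope nat_scope.
Local Open Scope fset_scope.

(* The cell [a, a + (1,1)] is represented by its lower left corner a, so that
   lattice points and cells share the carrier nat * nat. *)
Notation point := (nat * nat)%type.
Notation cell := (nat * nat)%type.

Definition cell_vertices (C : cell) : {fset point} :=
  [fset (C.1, C.2); (C.1.+1, C.2); (C.1, C.2.+1); (C.1.+1, C.2.+1)].

(* An edge is represented by the set of its two end points. *)
Definition cell_edges (C : cell) : seq {fset point} :=
  [:: [fset (C.1, C.2); (C.1.+1, C.2)];
      [fset (C.1, C.2); (C.1, C.2.+1)];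
      [fset (C.1.+1, C.2); (C.1.+1, C.2.+1)];
      [fset (C.1, C.2.+1); (C.1.+1, C.2.+1)]].

(* The intersection of two cells is the convex hull of their common vertices. *)
Definition edge_adjacent : rel cell :=
  fun C D => cell_vertices C `&` cell_vertices D \in cell_edges C.

Definition edge_connected (Q : pred cell) : Prop :=
  forall C D : cell, Q C -> Q D ->
    exists2 s : seq cell, path edge_adjacent C s && all Q s & last C s = D.

Definition is_polyomino (P : {fset cell}) : Prop :=
  P != fset0 /\ edge_connected (fun C => C \in P).

Definition is_simple (P : {fset cell}) : Prop :=
  edge_connected (fun C => C \notin P).

Definition is_thin (P : {fset cell}) : Prop :=
  forall i j : nat,
    ~~ [&& (i, j) \in P, (i.+1, j) \in P, (i, j.+1) \in P
         & (i.+1, j.+1) \in P].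

Definition vertices (P : {fset cell}) : {fset point} :=
  \bigcup_(C <- P) cell_vertices C.

Definition is_inner_interval (P : {fset cell}) (a b : point) : Prop :=
  [/\ a.1 < b.1, a.2 < b.2
    & forall r s : nat, a.1 <= r < b.1 -> a.2 <= s < b.2 -> (r, s) \in P].

Definition rooks_attack (P : {fset cell}) (C D : cell) : bool :=
  (C != D) &&
  (((C.2 == D.2) &&
     all (fun i => (i, C.2) \in P)
         (index_iota (minn C.1 D.1).+1 (maxn C.1 D.1)))
   || ((C.1 == D.1) &&
     all (fun j => (C.1, j) \in P)
         (index_iota (minn C.2 D.2).+1 (maxn C.2 D.2)))).

Definition rook_configurations (P : {fset cell}) (k : nat) :
    {fset {fset cell}} :=
  [fset S in fpowerset P | (#|` S| == k)
    && [forall C : S, forall D : S, ~~ rooks_attack P (val C) (val D)]].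

Definition rook_count (P : {fset cell}) (k : nat) : nat :=
  #|` rook_configurations P k|.

(* At most #|` P| rooks fit on P, hence the bound on k. *)
Definition rook_number (P : {fset cell}) : nat :=
  \max_(k < #|` P|.+1 | rook_count P k != 0) k.

Local Open Scope ring_scope.

Definition rook_polynomial (P : {fset cell}) : {poly int} :=
  \poly_(k < (rook_number P).+1) (rook_count P k)%:Z.

Definition ideal_generated (A : comNzRingType) (G : A -> Prop) : {pred A} :=
  fun f => `[< exists s : seq (A * A),
     (forall q, q \in s -> G q.2) /\ f = \sum_(q <- s) q.1 * q.2 >].

Lemma ideal_generated_closed (A B : comNzRingType) (ev : {rmorphism A -> B})
    (G : A -> Prop) :
  (forall g, G g -> ev g = 0) -> idealr_closed (ideal_generated G).
Proof.
move=> evG; split.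
- by apply/asboolP; exists [::]; split=> //; rewrite big_nil.
- apply/negP => /asboolP[s [sG e1]].
  have /eqP : ev 1 = 0.
    rewrite e1 rmorph_sum big_seq big1 // => q /sG /evG e0.
    by rewrite rmorphM e0 mulr0.
  by rewrite rmorph1 oner_eq0.
- move=> a u v /asboolP[s [sG ->]] /asboolP[t [tG ->]].
  apply/asboolP; exists ([seq (a * q.1, q.2) | q <- s] ++ t); split.
    move=> q; rewrite mem_cat => /orP[/mapP[q' /sG Gq' ->] //|/tG //].
  rewrite big_cat big_map mulr_sumr; congr (_ + _).
  by apply: eq_bigr => q _; rewrite mulrA.
Qed.

Definition has_dimension (K : fieldType) (V : lmodType K) (W : V -> Prop)
    (n : nat) : Prop :=
  exists b : 'I_n -> V,
    (forall i, W (b i)) /\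
    (forall v, W v ->
       exists! c : {ffun 'I_n -> K}, v = \sum_(i < n) c i *: b i).

Lemma has_dimension_exists (K : fieldType) (V : lmodType K) (W : V -> Prop)
    (n : nat) (b : 'I_n -> V) :
  (forall i, W (b i)) ->
  (forall v, W v -> exists c : {ffun 'I_n -> K}, v = \sum_(i < n) c i *: b i) ->
  exists m, has_dimension W m.
Proof.
move=> Wb spb.
pose spans m := `[< exists b : 'I_m -> V, (forall i, W (b i)) /\
  forall v, W v -> exists c : {ffun 'I_m -> K}, v = \sum_(i < m) c i *: b i >].
have ex : exists m, spans m by exists n; apply/asboolP; exists b.
exists (ex_minn ex); case: ex_minnP => m /asboolP[{spb Wb}b [Wb spb]] minm.
exists b; split=> // v Wv; have [c vE] := spb v Wv.
exists c; split=> // c' vE'; apply/eqP/negPn/negP => neq_cc'.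
pose d := [ffun i => c i - c' i].
have d0 : \sum_(i < m) d i *: b i = 0.
  transitivity (\sum_(i < m) c i *: b i - \sum_(i < m) c' i *: b i).
    by rewrite -sumrB; apply: eq_bigr => i _; rewrite ffunE scalerBl.
  by rewrite -vE -vE' subrr.
have [i0 di0] : exists i0, d i0 != 0.
  apply: contrapT => /forallNP d_eq0; move/negP: neq_cc'; apply.
  apply/eqP/ffunP => i; apply/eqP; rewrite -subr_eq0.
  by have := d_eq0 i; rewrite ffunE => /negP/negPn.
clearbody d; destruct m as [|m].
  by case: i0 {di0}.
suff /minm : spans m by rewrite ltnn.
apply/asboolP; exists (b \o lift i0); split=> [i|w Ww]; first exact: Wb.
have [e wE] := spb w Ww.
exists [ffun j => e (lift i0 j) - e i0 / d i0 * d (lift i0 j)].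
transitivity (\sum_(i < m.+1) (e i - e i0 / d i0 * d i) *: b i).
  rewrite (eq_bigr (fun i => e i *: b i - (e i0 / d i0) *: (d i *: b i))).
    by rewrite sumrB -scaler_sumr d0 scaler0 subr0.
  by move=> i _; rewrite scalerBl scalerA.
rewrite (bigD1_ord i0) //= divfK // subrr scale0r add0r.
by apply: eq_bigr => j _; rewrite ffunE.
Qed.

Definition has_prime_chain (A : comNzRingType) (n : nat) : Prop :=
  exists p : nat -> prime_idealr A,
    forall i : nat, (i < n)%N ->
      {subset p i <= p i.+1} /\ ~ {subset p i.+1 <= p i}.

Definition is_krull_dimension (A : comNzRingType) (d : nat) : Prop :=
  has_prime_chain A d /\ (forall n, has_prime_chain A n -> (n <= d)%N).

(* The variable x_v is 'X_(enum_rank v). *)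
Notation polyomino_ring K P := {mpoly K[#|{: vertices P}|]}.

Definition polyomino_binomial (K : fieldType) (P : {fset cell})
    (f : polyomino_ring K P) : Prop :=
  exists a b c d : vertices P,
    [/\ is_inner_interval P (val a) (val b),
        val c = ((val a).1, (val b).2),
        val d = ((val b).1, (val a).2)
      & f = 'X_(enum_rank a) * 'X_(enum_rank b)
            - 'X_(enum_rank c) * 'X_(enum_rank d)].

Definition polyomino_ideal (K : fieldType) (P : {fset cell}) :
    {pred polyomino_ring K P} :=
  ideal_generated (@polyomino_binomial K P).

Lemma polyomino_ideal_closed (K : fieldType) (P : {fset cell}) :
  idealr_closed (@polyomino_ideal K P).
Proof.
apply: (@ideal_generated_closed _ K (meval (fun=> 0))).
move=> g [a [b [c [d [_ _ _ ->]]]]].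
by rewrite rmorphB !rmorphM /= !mevalXU !mulr0 subrr.
Qed.

HB.instance Definition _ (K : fieldType) (P : {fset cell}) :=
  isIdealr.Build (polyomino_ring K P) (@polyomino_ideal K P)
    (@polyomino_ideal_closed K P).

Definition polyomino_algebra (K : fieldType) (P : {fset cell}) : Type :=
  {ideal_quot (@polyomino_ideal K P)}.

HB.instance Definition _ (K : fieldType) (P : {fset cell}) :=
  GRing.ComNzRing.on (polyomino_algebra K P).

Definition to_algebra (K : fieldType) (P : {fset cell})
    (f : polyomino_ring K P) : polyomino_algebra K P :=
  (\pi_({ideal_quot (@polyomino_ideal K P)}) f)%qT.

HB.instance Definition _ (K : fieldType) (P : {fset cell}) :=
  GRing.RMorphism.copy (@to_algebra K P)
    (\pi_({ideal_quot (@polyomino_ideal K P)}))%qT.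

Section Scaling.
Variables (K : fieldType) (P : {fset cell}).

Definition algebra_scale (a : K) (x : polyomino_algebra K P) :=
  @to_algebra K P a%:MP * x.

Fact algebra_scaleA a b x :
  algebra_scale a (algebra_scale b x) = algebra_scale (a * b) x.
Proof. by rewrite /algebra_scale mulrA -rmorphM -mpolyCM. Qed.

Fact algebra_scale1 : left_id 1 algebra_scale.
Proof. by move=> x; rewrite /algebra_scale mpolyC1 rmorph1 mul1r. Qed.

Fact algebra_scaleDr : right_distributive algebra_scale +%R.
Proof. by move=> a x y; rewrite /algebra_scale mulrDr. Qed.

Fact algebra_scaleDl x :
  {morph algebra_scale^~ x : a b / a + b}.
Proof. by move=> a b; rewrite /algebra_scale mpolyCD rmorphD mulrDl. Qed.

HB.instance Definition _ :=
  GRing.Zmodule_isLmodule.Build K (polyomino_algebra K P)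
    algebra_scaleA algebra_scale1 algebra_scaleDr algebra_scaleDl.

End Scaling.

Definition homogeneous_part (K : fieldType) (P : {fset cell}) (k : nat)
    (x : polyomino_algebra K P) : Prop :=
  exists2 f : polyomino_ring K P, f \is k.-homog & x = to_algebra f.

Lemma homogeneous_part_dimension (K : fieldType) (P : {fset cell}) (k : nat) :
  exists m, has_dimension (@homogeneous_part K P k) m.
Proof.
set n := #|{: vertices P}|.
pose mon (m : 'X_{1..n < k.+1}) : polyomino_ring K P :=
  if mdeg m == k then 'X_[m] else 0.
pose b (i : 'I_#|{: 'X_{1..n < k.+1}}|) : polyomino_algebra K P :=
  to_algebra (mon (enum_val i)).
apply: (@has_dimension_exists _ _ _ _ b) => [i|_ [f fk ->]].
  exists (mon (enum_val i)) => //; rewrite /mon; case: ifP => [mk|_].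
    by rewrite dhomogX.
  exact: dhomog0.
exists [ffun i => f@_(enum_val i : 'X_{1..n < k.+1})].
have fE : f = \sum_(m : 'X_{1..n < k.+1}) f@_m *: mon m.
  have szf : (msize f <= k.+1)%N.
    rewrite msizeE; apply/bigmax_leqP_seq => m /(dhomog_mf fk) /= mk _.
    by rewrite ltnS mk.
  rewrite {1}(mpolywE szf); apply: eq_bigr => m _; rewrite /mon; case: ifP => // mk.
  by rewrite (dhomog_nemf_coeff fk) ?mk // !scale0r.
rewrite {1}fE rmorph_sum (reindex (@enum_val _ predT)) /=; last first.
  by exists enum_rank => i _; rewrite ?enum_valK ?enum_rankK.
apply: eq_bigr => i _; rewrite ffunE -mul_mpolyC rmorphM //.
Qed.

Definition hilbert_function (K : fieldType) (P : {fset cell}) (k : nat) : nat :=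
  projT1 (cid (homogeneous_part_dimension K P k)).

(* HP(t) = h(t) / (1 - t)^d is the identity HP(t) * (1 - t)^d = h(t) of formal
   power series, compared coefficient by coefficient. *)
Definition is_reduced_hilbert_series (K : fieldType) (P : {fset cell})
    (h : {poly int}) (d : nat) : Prop :=
  [/\ forall k : nat,
        \sum_(i < k.+1)
           (hilbert_function K P i)%:Z * ((1 - 'X : {poly int}) ^+ d)`_(k - i)
        = h`_k,
      h.[1] != 0
    & is_krull_dimension (polyomino_algebra K P) d].

(* Main.v *)
Require Import Defs.
From mathcomp Require Import all_boot all_order all_algebra.
From mathcomp Require Import finmap boolp mpoly zify.

(* A simple thin polyomino can be built cell by cell, each new cell C being glued
   along one edge (a, b) of the cells already present and bringing two new
   vertices: c next to a and d next to b.  Call strips the classes of parallel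
   edges cut out by the maximal rows and columns of cells; orienting all edges of
   a strip alike, from a good end point to the other one, C adds the edge (c, d)
   to the strip S of (a, b) and creates the strip of the edges (c, a), (d, b).
   Orienting each binomial of the polyomino ideal as x_d x_g -> x_c x_o, where
   (g, o) is an edge of S older than (c, d), gives a terminating and locally
   confluent rewriting system, so that the irreducible monomials, which are those
   not divisible by any x_d x_g, form a basis of K[P].  For a set A of strips let
   H_A be the generating function of the irreducible monomials avoiding the good
   points of the strips in A.  Adding C changes H_A into
   H_A / (1 - t) + t H_(A + S) / (1 - t)^2 when A contains neither S nor the new
   strip, and rooks are matchings in the graph with strips as vertices and cells
   as edges, whose matching polynomial obeys the same recursion up to powers of
   1 - t.  Hence (1 - t)^(|P| + 2) HP(t) is the rook polynomial; since it does not
   vanish at 1, it is the reduced numerator. *)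

Set Implicit Arguments.
Unset Strict Implicit.
Unset Printing Implicit Defensive.

Import GRing.Theory Num.Theory.

(** * Rewriting of monomials *)

Local Open Scope nat_scope.

Section Rewriting.

Variables (T : eqType) (n : nat) (idx : T -> 'I_n).

Local Notation rule := ((T * T) * (T * T))%type.
Local Notation U p := (U_(idx p))%MM.

(** Simplicity forbids pinches and, with thinness, cycles of cells, so a new cell meets the earlier
    ones along one edge and brings exactly two vertices. Thinness also makes every inner interval
    one cell wide or high, so the generators of the ideal are the binomials of pairs of edges in one
    strip. After that, the algebra only sees strips ([grown]); coordinates are confined to [built].
    The refinement by A is forced: a monomial divisible by x_d must avoid all good points of S, so
    the recursion leaves the case of empty A. The orientation serves this recursion: c is good for S
    and for the new strip, d for the new strip only. Putting the new strip in A thus removes both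
    new variables, putting S in A only x_c. For confluence, the point is that two strips sharing a
    good point cross in a cell there, which lets a variable be traded along one strip while a rule
    acts in the other. There is one strip at the start and one more per cell. If n strips lie
    outside A, then (1 - t)^(n + 1) H_A is the generating function of the matchings avoiding A; for
    empty A the exponent is |P| + 2. *)

Definition rewrites (R : seq rule) (m m' : 'X_{1..n}) : Prop :=
  exists2 u, u \in R &
    exists r, m = (U u.1.1 + U u.1.2 + r)%MM /\ m' = (U u.2.1 + U u.2.2 + r)%MM.

Inductive reduces (R : seq rule) : 'X_{1..n} -> 'X_{1..n} -> Prop :=
| reduces_refl m : reduces R m m
| reduces_step m m1 m2 : rewrites R m m1 -> reduces R m1 m2 -> reduces R m m2.

Definition joinable (R : seq rule) (m1 m2 : 'X_{1..n}) : Prop :=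
  exists m, reduces R m1 m /\ reduces R m2 m.

Definition locally_confluent (R : seq rule) : Prop :=
  forall m m1 m2, rewrites R m m1 -> rewrites R m m2 -> joinable R m1 m2.

Definition irreducible (R : seq rule) (m : 'X_{1..n}) : bool :=
  all (fun u : rule => (m (idx u.1.1) == 0) || (m (idx u.1.2) == 0)) R.

Lemma reduces_trans R m1 m2 m3 :
  reduces R m1 m2 -> reduces R m2 m3 -> reduces R m1 m3.
Proof.
by move=> r12; elim: r12 m3 => // m m' m'' s _ IH m3 /IH; apply: reduces_step.
Qed.

Lemma reduces_rule R p q y z r m m' :
  ((p, q), (y, z)) \in R -> m = (U p + U q + r)%MM -> m' = (U y + U z + r)%MM ->
  reduces R m m'.
Proof.
move=> uR mE mE'; apply: reduces_step (reduces_refl _ _).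
by exists (p, q, (y, z)) => //; exists r.
Qed.

Lemma reduces_add R m m' r :
  reduces R m m' -> reduces R (m + r)%MM (m' + r)%MM.
Proof.
elim=> [m1|m1 m2 m3 [u uR [s [-> ->]]] _ IH]; first exact: reduces_refl.
apply: reduces_trans IH; case: u uR => [[p q] [y z]] uR /=.
by apply: (@reduces_rule _ _ _ _ _ (s + r)%MM _ _ uR); rewrite -addmA.
Qed.

Lemma reduces_sub R R' m m' :
  {subset R <= R'} -> reduces R m m' -> reduces R' m m'.
Proof.
move=> sRR'; elim=> [m1|m1 m2 m3 [u /sRR' uR ur] _ IH]; first exact: reduces_refl.
by apply: reduces_step IH; exists u.
Qed.

Lemma joinable_refl R m : joinable R m m.
Proof. by exists m; split; apply: reduces_refl. Qed.

Lemma joinable_sym R m1 m2 : joinable R m1 m2 -> joinable R m2 m1.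
Proof. by case=> m [? ?]; exists m. Qed.

Lemma joinable_add R m m' r :
  joinable R m m' -> joinable R (m + r)%MM (m' + r)%MM.
Proof.
by case=> m1 [? ?]; exists (m1 + r)%MM; split; apply: reduces_add.
Qed.

Lemma joinable_sub R R' m m' :
  {subset R <= R'} -> joinable R m m' -> joinable R' m m'.
Proof. by move=> s [m1 [? ?]]; exists m1; split; apply: reduces_sub s _. Qed.

Lemma reduces_joinable R m m' : reduces R m m' -> joinable R m m'.
Proof. by exists m'; split=> //; apply: reduces_refl. Qed.

Lemma joinable_reducesr R m1 m2 m3 :
  reduces R m2 m3 -> joinable R m1 m3 -> joinable R m1 m2.
Proof. by move=> r23 [m [r1 r3]]; exists m; split=> //; apply: reduces_trans r3. Qed.

(** Unique factorization; it compares the two factorizations of a monomial to which two rules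
    apply. *)
Lemma mnm1_exchange (i j : 'I_n) (r r' : 'X_{1..n}) :
  i != j -> (U_(i) + r)%MM = (U_(j) + r')%MM ->
  exists s, r = (U_(j) + s)%MM /\ r' = (U_(i) + s)%MM.
Proof.
move=> nij /mnmP e.
have le_r : (U_(j) <= r)%MM.
  by rewrite lep1mP; move: (e j); rewrite !mnmDE !mnm1E eqxx (negPf nij); lia.
exists (r - U_(j))%MM; have rE := submK le_r; split; first by rewrite addmC rE.
apply/mnmP=> k; move/mnmP: rE => /(_ k); move: (e k).
by rewrite !mnmDE !mnmBE; lia.
Qed.

Section Termination.

Variables (R : seq rule) (wti : 'I_n -> nat).
Hypothesis wtR : forall u, u \in R -> wti (idx u.2.1) + wti (idx u.2.2) <
                                      wti (idx u.1.1) + wti (idx u.1.2).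
Hypothesis distinct_lhs : forall u, u \in R -> idx u.1.1 != idx u.1.2.
Hypothesis lcR : locally_confluent R.

Definition weight (m : 'X_{1..n}) : nat := \sum_(i < n) m i * wti i.

Lemma weightD m1 m2 : weight (m1 + m2)%MM = weight m1 + weight m2.
Proof.
by rewrite /weight -big_split; apply: eq_bigr => i _; rewrite mnmDE mulnDl.
Qed.

Lemma weight1 i : weight U_(i)%MM = wti i.
Proof.
rewrite /weight (bigD1 i) //= big1 ?addn0 => [|j /negPf nji].
  by rewrite mnm1E eqxx mul1n.
by rewrite mnm1E eq_sym nji.
Qed.

Lemma weight_rewrites m m' : rewrites R m m' -> weight m' < weight m.
Proof.
case=> u /wtR wtu [r [-> ->]]; rewrite !weightD !weight1; lia.
Qed.

(** Two positive exponents amount to divisibility by the left-hand side because, by [distinct_lhs],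
    no left-hand side is a square. *)
Lemma irreducibleP m : reflect (forall m', ~ rewrites R m m') (irreducible R m).
Proof.
apply: (iffP allP) => [irr m' [u uR [r [mE _]]]|nor u uR].
  by have := irr _ uR; rewrite mE !mnmDE !mnm1E !eqxx; lia.
apply/negPn/negP; rewrite negb_or => /andP[m1 m2].
case: (nor (m - U u.1.1 - U u.1.2 + U u.2.1 + U u.2.2)%MM).
exists u => //; exists (m - U u.1.1 - U u.1.2)%MM.
split; apply/mnmP=> i; rewrite !mnmDE !mnmBE ?mnm1E; last lia.
have := distinct_lhs uR; case: (idx u.1.1 =P i) => [<-|_].
  by rewrite eq_sym => /negPf -> /=; move: m1; rewrite -lt0n; lia.
case: (idx u.1.2 =P i) => [<- _|_ _] /=; last by lia.
  by move: m2; rewrite -lt0n; lia.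
Qed.

Lemma reduces_irreducible m : exists2 s, reduces R m s & irreducible R s.
Proof.
have [k] := ubnP (weight m); elim: k m => // k IH m wm.
have [im|/negP im] := boolP (irreducible R m).
  by exists m => //; apply: reduces_refl.
have [m' mm'] : exists m', rewrites R m m'.
  by apply: contrapT => /forallNP nm; apply/im/irreducibleP.
have [|s m's irrs] := IH m'; first by have := weight_rewrites mm'; lia.
by exists s => //; apply: reduces_step m's.
Qed.

Lemma irreducible_reduces m s : irreducible R m -> reduces R m s -> m = s.
Proof. by move=> /irreducibleP irr ms; case: ms irr => // m1 m2 m3 s12 _ /(_ _ s12). Qed.

(** Newman's lemma, by induction on the weight: the first steps towards [s] and [s'] are joined at
    some [x], and a normal form [t] of [x] equals both. *)
Lemma reduces_unique m s s' :
  reduces R m s -> irreducible R s -> reduces R m s' -> irreducible R s' -> s = s'.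
Proof.
have [k] := ubnP (weight m); elim: k m s s' => // k IH m s s' + ms.
case: ms => [m0|m0 m1 m2 r01 r12] wm irs rs' irs'.
  exact: irreducible_reduces irs rs'.
case: rs' irs' r01 wm => [m3|m3 m4 m5 r34 r45] irs' r31 wm.
  by move/irreducibleP: irs' => /(_ _ r31).
have [x [r1x r4x]] := lcR r31 r34.
have [t rxt irt] := reduces_irreducible x.
have -> : m2 = t.
  apply: (IH m1) => //; first by have := weight_rewrites r31; lia.
  exact: reduces_trans rxt.
apply: (IH m4) => //; first by have := weight_rewrites r34; lia.
exact: reduces_trans rxt.
Qed.

Lemma joinable_unique m m' s s' : joinable R m m' ->
  reduces R m s -> irreducible R s -> reduces R m' s' -> irreducible R s' -> s = s'.
Proof.
move=> [x [mx m'x]] ms irs m's' irs'.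
have [t xt irt] := reduces_irreducible x.
have -> : s = t by apply: reduces_unique ms irs _ irt; apply: reduces_trans xt.
by apply: reduces_unique _ irt m's' irs'; apply: reduces_trans xt.
Qed.

End Termination.

End Rewriting.

(** * Growing systems of strips *)

Ltac mnm_ac := clear; apply/mnmP=> ?; rewrite /= !mnmDE; lia.

Section Growth.

Variable T : eqType.

Local Notation rule := ((T * T) * (T * T))%type.
Local Notation strip_edge := (T * (T * T))%type.

Definition attach_edges (S a b c d : T) (E : seq strip_edge) : seq strip_edge :=
  [:: (S, (c, d)), (c, (c, a)), (c, (d, b)) & E].

(** The new strip needs no rule of its own: its only binomial x_c x_b - x_d x_a is already given by
    the edge (a, b) of [S]. *)
Definition attach_rules (S c d : T) (E : seq strip_edge) (R : seq rule) : seq rule :=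
  [seq ((d, e.2.1), (c, e.2.2)) | e <- E & e.1 == S] ++ R.

(* In [grown V E R G], [V] lists the points, latest first; [(L, (g, o))] in [E]
   is an edge of the strip labelled [L] with good end point [g]; a rule
   [((p, q), (y, z))] in [R] rewrites [x_p x_q] to [x_y x_z]; and each cell is
   recorded in [G] by the labels of its two strips.  The good point [c] of a new
   edge serves as a label for the strip created with it. *)
Inductive grown :
  seq T -> seq strip_edge -> seq rule -> seq (T * T) -> Prop :=
| grown_edge a b : a != b -> grown [:: b; a] [:: (a, (a, b))] [::] [::]
| grown_cell V E R G S a b c d :
    grown V E R G -> (S, (a, b)) \in E -> c \notin V -> d \notin V -> c != d ->
    grown [:: d, c & V] (attach_edges S a b c d E) (attach_rules S c d E R)
          ((S, c) :: G).

Lemma attach_edgesP S a b c d E L g o :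
  (L, (g, o)) \in attach_edges S a b c d E ->
  [\/ [/\ L = S, g = c & o = d], [/\ L = c, g = c & o = a],
      [/\ L = c, g = d & o = b] | (L, (g, o)) \in E].
Proof.
rewrite !inE => /orP[/eqP[-> -> ->]|]; first by constructor 1.
case/orP=> [/eqP[-> -> ->]|]; first by constructor 2.
case/orP=> [/eqP[-> -> ->]|eE]; first by constructor 3.
by constructor 4.
Qed.

Lemma mem_attach_edges S a b c d E :
  [/\ (S, (c, d)) \in attach_edges S a b c d E,
      (c, (c, a)) \in attach_edges S a b c d E,
      (c, (d, b)) \in attach_edges S a b c d E
    & {subset E <= attach_edges S a b c d E}].
Proof.
by split; rewrite ?inE ?eqxx ?orbT // => e eE; rewrite !inE eE !orbT.
Qed.

Lemma attach_rulesP S c d E R u :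
  u \in attach_rules S c d E R ->
  (exists2 e, (S, e) \in E & u = ((d, e.1), (c, e.2))) \/ u \in R.
Proof.
rewrite mem_cat => /orP[/mapP[[L e]]|]; last by right.
by rewrite mem_filter /= => /andP[/eqP-> eE ->]; left; exists e.
Qed.

Lemma mem_attach_rules S c d E R :
  (forall e, (S, e) \in E -> ((d, e.1), (c, e.2)) \in attach_rules S c d E R) /\
  {subset R <= attach_rules S c d E R}.
Proof.
split=> [e eE|u uR]; rewrite mem_cat ?uR ?orbT //.
by apply/orP; left; apply/mapP; exists (S, e); rewrite // mem_filter eqxx.
Qed.

Lemma grown_mem V E R G L g o : grown V E R G -> (L, (g, o)) \in E ->
  [/\ L \in V, g \in V & o \in V].
Proof.
move=> gr; elim: gr L g o => [a b _|V' E' R' G' S a b c d _ IH SE _ _ _] L g o.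
  by rewrite !inE => /eqP[-> -> ->]; rewrite !eqxx !orbT.
have [SV aV bV] := IH _ _ _ SE.
by case/attach_edgesP=> [[-> -> ->]|[-> -> ->]|[-> -> ->]|/IH[]];
  rewrite !inE ?eqxx ?orbT ?SV ?aV ?bV ?orbT // => -> -> ->; rewrite !orbT.
Qed.

Lemma grown_uniq V E R G : grown V E R G -> uniq V.
Proof.
elim=> [a b nab|V' E' R' G' S a b c d _ IH _ cV dV ncd] /=.
  by rewrite inE eq_sym nab.
by rewrite inE negb_or eq_sym ncd dV cV.
Qed.

Lemma grown_rule V E R G u : grown V E R G -> u \in R ->
  u.1.1 != u.1.2 /\
  exists S, (S, (u.1.2, u.2.2)) \in E /\ (S, (u.2.1, u.1.1)) \in E.
Proof.
move=> gr; elim: gr u => // V' E' R' G' S a b c d gr IH SE _ dV _ u.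
have [m1 m2 m3 m4] := mem_attach_edges S a b c d E'.
case/attach_rulesP=> [[[g o] eE ->] /=|/IH[? [L [L1 L2]]]]; last first.
  by split=> //; exists L; split; apply: m4.
split; last by exists S; split=> //; apply: m4.
by have [_ gV _] := grown_mem gr eE; apply: contraNneq dV => ->.
Qed.

Lemma grown_rule_mem V E R G u : grown V E R G -> u \in R ->
  [/\ u.1.1 \in V, u.1.2 \in V, u.2.1 \in V & u.2.2 \in V].
Proof.
move=> gr /(grown_rule gr)[_ [S []]].
by move=> /(grown_mem gr)[_ ? ?] /(grown_mem gr)[_ ? ?].
Qed.

Lemma grown_fresh V E R G L g o x : grown V E R G -> (L, (g, o)) \in E ->
  x \notin V -> [/\ L <> x, g <> x & o <> x].
Proof.
by move=> gr /(grown_mem gr)[LV gV oV] /negP xV; split=> e; apply: xV; rewrite -e.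
Qed.

Lemma grown_functional V E R G S g o o' : grown V E R G ->
  (S, (g, o)) \in E -> (S, (g, o')) \in E -> o = o'.
Proof.
move=> gr; elim: gr S g o o' => [a b _|V' E' R' G' S a b c d gr IH SE cV dV ncd].
  by move=> S g o o'; rewrite !inE => /eqP[_ _ ->] /eqP[_ _ ->].
have [Sc _ _] := grown_fresh gr SE cV; move/eqP in ncd.
(* Each of the two edges is one of the three new ones or an old one. Distinctness of the labels and
   freshness of [c] and [d] settle everything but two old edges. The same case analysis recurs
   below. *)
move=> L g o o' /attach_edgesP[[? ? ?]|[? ? ?]|[? ? ?]|eE]
  /attach_edgesP[[? ? ?]|[? ? ?]|[? ? ?]|eE']; try congruence;
  try (by case: (grown_fresh gr eE cV) (grown_fresh gr eE dV) => ? ? ? [? ? ?]; congruence);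
  try (by case: (grown_fresh gr eE' cV) (grown_fresh gr eE' dV) => ? ? ? [? ? ?]; congruence).
exact: IH eE eE'.
Qed.

(* Two strips with a common good point [a] cross in a cell having [a] as a corner. *)
Lemma grown_crossing V E R G S S' a b h : grown V E R G -> S <> S' ->
  (S, (a, b)) \in E -> (S', (a, h)) \in E ->
  exists h', (S', (b, h')) \in E /\ (S, (h, h')) \in E.
Proof.
move=> gr; elim: gr S S' a b h => [a b _|V' E' R' G' S a b c d gr IH SE cV dV ncd].
  by move=> S S' g h h' nSS; rewrite !inE => /eqP[? _ _] /eqP[? _ _]; congruence.
have [Sc _ _] := grown_fresh gr SE cV; move/eqP in ncd.
have [m1 m2 m3 m4] := mem_attach_edges S a b c d E'.
move=> L L' g o o' nLL /attach_edgesP[[? ? ?]|[? ? ?]|[? ? ?]|eE]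
  /attach_edgesP[[? ? ?]|[? ? ?]|[? ? ?]|eE']; try congruence;
  try (by case: (grown_fresh gr eE cV) (grown_fresh gr eE dV) => ? ? ? [? ? ?]; congruence);
  try (by case: (grown_fresh gr eE' cV) (grown_fresh gr eE' dV) => ? ? ? [? ? ?]; congruence).
(* The only new point that is good for two strips is [c], where [S] and the new strip cross in the
   new cell; the opposite corner is [b]. *)
- by subst; exists b; split=> //; apply: m4.
- by subst; exists b; split=> //; apply: m4.
by have [h' [? ?]] := IH _ _ _ _ _ nLL eE eE'; exists h'; split; apply: m4.
Qed.

Lemma grown_label_fresh V E R G S N : grown V E R G -> (S, N) \in G ->
  S \in V /\ N \in V.
Proof.
move=> gr; elim: gr S N => // V' E' R' G' S a b c d gr IH SE _ _ _ L N.
rewrite !inE => /orP[/eqP[-> ->]|/IH[-> ->]]; last by rewrite !orbT.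
by have [-> _ _] := grown_mem gr SE; rewrite eqxx !orbT.
Qed.

Section Confluence.

Variables (n : nat) (idx : T -> 'I_n).

Local Notation U p := (U_(idx p))%MM.
Local Notation joinable := (joinable idx).

(** For two different edges of a strip, these monomials are the two sides of a single rule: that of
    the later edge in [S], or that of (a, b) when the strip is the new one. *)
Lemma grown_related V E R G S g o g' o' : grown V E R G ->
  (S, (g, o)) \in E -> (S, (g', o')) \in E ->
  joinable R (U g + U o')%MM (U g' + U o)%MM.
Proof.
move=> gr; elim: gr S g o g' o' => [a b _|V' E' R' G' S a b c d gr IH SE cV dV ncd].
  move=> S g o g' o'; rewrite !inE => /eqP[_ -> ->] /eqP[_ -> ->].
  exact: joinable_refl.
have [Sc _ _] := grown_fresh gr SE cV; move/eqP in ncd.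
have [r1 r2] := mem_attach_rules S c d E' R'.
have rule g o : (S, (g, o)) \in E' ->
  joinable (attach_rules S c d E' R') (U g + U d)%MM (U c + U o)%MM.
  move=> eE; apply/reduces_joinable/(reduces_rule (r1 _ eE) (r := 0%MM)).
    by rewrite addm0 addmC.
  by rewrite addm0.
move=> L g o g' o' /attach_edgesP[[? ? ?]|[? ? ?]|[? ? ?]|eE]
  /attach_edgesP[[? ? ?]|[? ? ?]|[? ? ?]|eE']; try congruence;
  try (by case: (grown_fresh gr eE cV) (grown_fresh gr eE dV) => ? ? ? [? ? ?]; congruence);
  try (by case: (grown_fresh gr eE' cV) (grown_fresh gr eE' dV) => ? ? ? [? ? ?]; congruence);
  subst.
- exact: joinable_refl.
- by apply: joinable_sym; apply: rule.
- exact: joinable_refl.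
- by rewrite [X in joinable _ _ X]addmC; apply: joinable_sym; apply: rule.
- by rewrite [X in joinable _ X _]addmC; apply: rule.
- exact: joinable_refl.
- exact: rule.
by apply: joinable_sub r2 _; apply: IH eE eE'.
Qed.

(* Trading [p] for its partner [h] in the strip [S] on the left-hand side of a
   rule [p q -> y z] is matched by trading [y] or [z] on the right-hand side. *)
Definition slides (E : seq strip_edge) (R : seq rule) (S h q y z : T) : Prop :=
  exists h' w, ((S, (y, h')) \in E /\ w = z \/ (S, (z, h')) \in E /\ w = y) /\
    joinable R (U h + U q)%MM (U h' + U w)%MM.

Lemma slides_sub E E' R R' S h q y z : {subset E <= E'} -> {subset R <= R'} ->
  slides E R S h q y z -> slides E' R' S h q y z.
Proof.
move=> sE sR [h' [w [mem j]]]; exists h', w; split; last exact: joinable_sub j.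
by case: mem => [[/sE ? ->]|[/sE ? ->]]; [left|right].
Qed.

(** For a new rule x_d x_g -> x_c x_o: [d] is good only in the new strip, where its trade for [b] is
    matched by trading [c] for [a]. In [S], trading [g] for [o] is matched by trading [c] for [d].
    In another strip, trading [g] for [h] is matched by trading [o] for the fourth corner h' of the
    crossing, and (h, h') is again an edge of [S]. *)
Lemma grown_slides V E R G p q y z : grown V E R G -> ((p, q), (y, z)) \in R ->
  (forall S h, (S, (p, h)) \in E -> slides E R S h q y z) /\
  (forall S h, (S, (q, h)) \in E -> slides E R S h p y z).
Proof.
move=> gr; elim: gr p q y z => // V' E' R' G' S a b c d gr IH SE cV dV ncd p q y z.
have [Sc _ _] := grown_fresh gr SE cV; move/eqP in ncd.
have [m1 m2 m3 m4] := mem_attach_edges S a b c d E'.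
have [r1 r2] := mem_attach_rules S c d E' R'.
case/attach_rulesP=> [[[g o] gE [-> -> -> ->]]|uR]; last first.
  have [pV qV _ _] := grown_rule_mem gr uR; have [Hp Hq] := IH _ _ _ _ uR.
  have nc x : x \in V' -> x <> c by move=> xV e; move/negP: cV; rewrite -e.
  have nd x : x \in V' -> x <> d by move=> xV e; move/negP: dV; rewrite -e.
  split=> L h /attach_edgesP[[_ e _]|[_ e _]|[_ e _]|eE];
    try by [case: (nc _ pV)|case: (nd _ pV)|case: (nc _ qV)|case: (nd _ qV)].
    by apply: slides_sub m4 r2 _; apply: Hp.
  by apply: slides_sub m4 r2 _; apply: Hq.
have [_ gc _] := grown_fresh gr gE cV; have [_ gd _] := grown_fresh gr gE dV.
split=> L h /attach_edgesP[[eL e eh]|[eL e eh]|[eL e eh]|eE] /=; try congruence.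
- rewrite eL eh; exists a, o; split; first by left.
  by rewrite addmC; apply: joinable_sub r2 _; apply: grown_related gr gE SE.
- by case: (grown_fresh gr eE dV).
have [eL|nL] := eqVneq L S.
  rewrite eL in eE *; rewrite (grown_functional gr eE gE); exists d, o.
  by split; [left|rewrite addmC; apply: joinable_refl].
have [h' [hh' ShE]] := grown_crossing gr (nesym (elimN eqP nL)) gE eE.
exists h', c; split; first by right; split=> //; apply: m4.
apply/reduces_joinable/(reduces_rule (r1 _ ShE) (r := 0%MM)); rewrite addm0 //=.
  by rewrite addmC.
by rewrite addmC.
Qed.

Lemma rewrites_attach S c d E R m m' : rewrites idx (attach_rules S c d E R) m m' ->
  (exists g o r, [/\ (S, (g, o)) \in E, m = (U d + U g + r)%MM
                   & m' = (U c + U o + r)%MM]) \/ rewrites idx R m m'.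
Proof.
case=> u /attach_rulesP[[[g o] eE ->] [r [-> ->]]|uR [r ur]]; last first.
  by right; exists u => //; exists r.
by left; exists g, o, r.
Qed.

(** Overlap of a new rule x_d x_g with an old rule x_p x_q. Since [d] is fresh, only [g] can be
    shared. If it is not, the two rewritings commute; if it is, trading [g] for [o] in [S] is a
    slide of the old rule. *)
Lemma attach_confluent V E R G S a b c d g o r m' :
  grown V E R G -> d \notin V -> {in d :: V &, injective idx} -> (S, (a, b)) \in E ->
  (S, (g, o)) \in E -> rewrites idx R (U d + U g + r)%MM m' ->
  joinable (attach_rules S c d E R) (U c + U o + r)%MM m'.
Proof.
set R' := attach_rules S c d E R => gr dV inj SE gE [[[p q] [y z]] uR [/= r' [mE ->]]].
have [r1 r2] : (forall e, (S, e) \in E -> ((d, e.1), (c, e.2)) \in R') /\ {subset R <= R'}.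
  exact: mem_attach_rules.
have [pV qV _ _] := grown_rule_mem gr uR; rewrite /= in pV qV.
have [_ gV _] := grown_mem gr gE.
have inj_neq x y' : x \in d :: V -> y' \in d :: V -> x != y' -> idx x != idx y'.
  by move=> xV yV; apply: contraNneq => /(inj _ _ xV yV) ->.
have neq_d x : x \in V -> idx d != idx x.
  move=> xV; apply: inj_neq; rewrite ?inE ?eqxx ?xV ?orbT //.
  by apply: contraNneq dV => ->.
have [slp slq] := grown_slides gr uR.
have mem_behead x : x \in V -> x \in d :: V by rewrite inE orbC => ->.
(* The slide yields an edge of [S] starting at [y] or [z]; the new rule for that edge rewrites the
   result of the old rule to x_c x_h' x_w, which is joinable with x_c x_h x_q'. *)
have close t h q' : slides E R S h q' y z ->
    joinable R' (U c + U h + (U q' + t))%MM (U y + U z + (U d + t))%MM.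
  case=> h' [w [mem /(joinable_sub r2) j]].
  have step : reduces idx R' (U y + U z + (U d + t))%MM (U c + U h' + (U w + t))%MM.
    case: mem => [[hE ->]|[hE ->]]; apply: (reduces_rule (r1 _ hE)) => /=;
      [|reflexivity| |reflexivity]; by mnm_ac.
  apply: (joinable_reducesr step).
  have := joinable_add (U c + t)%MM j; congr (joinable _ _ _);
    by mnm_ac.
rewrite -!addmA in mE.
have [s [e1 e2]] := mnm1_exchange (neq_d _ pV) mE.
have [s' [e3 e4]] := mnm1_exchange (neq_d _ qV) (esym e2).
rewrite e4 e3 in e1 *.
have [gp|ngp] := eqVneq g p.
  move: e1; rewrite -gp => /addmI ->; apply: close; apply: slp.
  by rewrite -gp.
have [t [-> e5]] := mnm1_exchange (inj_neq _ _ (mem_behead _ gV) (mem_behead _ pV) ngp) e1.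
have [gq|ngq] := eqVneq g q.
  move: e5; rewrite -gq => /addmI <-; apply: close; apply: slq.
  by rewrite -gq.
have [t' [-> ->]] : exists t', s' = (U g + t')%MM /\ t = (U q + t')%MM.
  by apply: mnm1_exchange e5; apply: inj_neq; rewrite ?mem_behead // eq_sym.
exists (U c + U o + (U y + U z + t'))%MM; split.
  by apply: (reduces_rule (r2 _ uR) (r := (U c + U o + t')%MM));
    mnm_ac.
by apply: (reduces_rule (r1 _ gE) (r := (U y + U z + t')%MM));
  mnm_ac.
Qed.

Lemma grown_confluent V E R G :
  grown V E R G -> {in V &, injective idx} -> locally_confluent idx R.
Proof.
elim=> [a b nab inj m m1 m2 [] //|V' E' R' G' S a b c d gr IH SE cV dV ncd inj].
have inj' : {in d :: V' &, injective idx}.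
  move=> x y xV yV; apply: inj; rewrite !inE in xV yV *.
    by case/orP: xV => ->; rewrite ?orbT.
  by case/orP: yV => ->; rewrite ?orbT.
have [r1 r2] := mem_attach_rules S c d E' R'.
have attach g o r m' := @attach_confluent _ _ _ _ _ _ _ c _ g o r m' gr dV inj' SE.
move=> m m1 m2 /rewrites_attach[[g [o [r [gE -> ->]]]]|mm1] /rewrites_attach[].
(* Two new rules share x_d. After cancelling it, x_o x_g' and x_o' x_g remain to be joined, and they
   come from two old edges of [S]. *)
- case=> [g' [o' [r' [gE' eqm ->]]]]; rewrite -!addmA in eqm; move/addmI in eqm.
  have [eqg|neqg] := eqVneq g g'.
    move: eqm gE; rewrite eqg => /addmI-> gE.
    by rewrite (grown_functional gr gE gE'); apply: joinable_refl.
  have [t [-> ->]] : exists t, r = (U g' + t)%MM /\ r' = (U g + t)%MM.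
    apply: mnm1_exchange eqm; apply: contraNneq neqg => /inj'->//; rewrite inE.
      by have [_ -> _] := grown_mem gr gE; rewrite orbT.
    by have [_ -> _] := grown_mem gr gE'; rewrite orbT.
  have /(joinable_add (U c + t)%MM) := grown_related gr gE' gE.
  move/(joinable_sub r2); congr (joinable _ _ _);
    by mnm_ac.
- exact: attach.
- case=> [g [o [r [gE mE ->]]]]; rewrite mE in mm1.
  exact/joinable_sym/(attach _ _ _ _ gE).
- by move=> mm2; apply: joinable_sub r2 _; apply: IH mm1 mm2 => x y xV yV;
    apply: inj; rewrite !inE ?xV ?yV !orbT.
Qed.

Lemma grown_weight V E R G : grown V E R G -> {in V &, injective idx} ->
  exists wt : 'I_n -> nat, forall u, u \in R ->
    wt (idx u.2.1) + wt (idx u.2.2) < wt (idx u.1.1) + wt (idx u.1.2).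
Proof.
elim=> [a b nab inj|V' E' R' G' S a b c d gr IH SE cV dV ncd inj].
  by exists (fun=> 0).
have [x y xV yV|wt wtP] := IH; first by apply: inj; rewrite !inE ?xV ?yV !orbT.
(* The variable of [d] outweighs any old one and that of [c] weighs nothing, so every new rule
   decreases the weight, whatever [g] and [o] are. *)
pose wt' i := if i == idx d then (\sum_j wt j).+1 else if i == idx c then 0 else wt i.
have wt'_old x : x \in V' -> wt' (idx x) = wt (idx x).
  move=> xV; rewrite /wt' !(inj_in_eq inj) ?inE ?eqxx ?xV ?orbT //.
  by case: eqP => [e|_]; [case/negP: dV; rewrite -e|case: eqP => // e; case/negP: cV; rewrite -e].
exists wt' => u /attach_rulesP[[[g o] eE ->]|uR]; last first.
  by have [? ? ? ?] := grown_rule_mem gr uR; rewrite !wt'_old //; apply: wtP.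
have [_ gV oV] := grown_mem gr eE; rewrite /= (wt'_old _ gV) (wt'_old _ oV).
have ncd' : (idx c == idx d) = false.
  by rewrite (inj_in_eq inj) ?inE ?eqxx ?orbT // (negPf ncd).
rewrite /wt' ncd' !eqxx.
by rewrite (bigD1 (idx o)) //=; lia.
Qed.

Lemma grown_normal_form V E R G : grown V E R G -> {in V &, injective idx} ->
  exists nf : 'X_{1..n} -> 'X_{1..n},
    [/\ forall m, reduces idx R m (nf m), forall m, irreducible idx R (nf m),
        forall m, irreducible idx R m -> nf m = m
      & forall m m', joinable R m m' -> nf m = nf m'].
Proof.
move=> gr inj; have [wt wtP] := grown_weight gr inj.
have lc := grown_confluent gr inj.
have dl u : u \in R -> idx u.1.1 != idx u.1.2.
  move=> uR; have [? ? _ _] := grown_rule_mem gr uR.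
  by rewrite (inj_in_eq inj) //; have [] := grown_rule gr uR.
have [nf nfP] := choice (fun m =>
  let: ex_intro2 s ms irs := reduces_irreducible wtP dl m in ex_intro _ s (conj ms irs)).
have nf_red m : reduces idx R m (nf m) by case: (nfP m).
have nf_irr m : irreducible idx R (nf m) by case: (nfP m).
exists nf; split=> // [m irm|m m' j].
  exact: esym (irreducible_reduces dl irm (nf_red m)).
exact: (joinable_unique wtP dl lc j (nf_red m) (nf_irr m) (nf_red m') (nf_irr m')).
Qed.

End Confluence.

End Growth.

(** * Counting standard monomials *)

Section BackwardDifference.

Local Open Scope ring_scope.

(* The coefficient sequence of [(1 - t) * \sum_k f k t ^ k]. *)
Definition diff (f : nat -> int) (k : nat) : int :=
  f k - (if k is k'.+1 then f k' else 0).

Definition shift (f : nat -> int) (k : nat) : int :=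
  if k is k'.+1 then f k' else 0.

Lemma diffD f g : diff (f \+ g) = diff f \+ diff g.
Proof. by apply/funext => -[|k]; rewrite /diff /GRing.add_fun /=; lia. Qed.

Lemma diff_shift f : diff (shift f) = shift (diff f).
Proof. by apply/funext => -[|[|k]] /=; rewrite /diff /shift //; lia. Qed.

Lemma diff_sum (f : nat -> nat) :
  diff (fun k => (\sum_(i < k.+1) f i)%N%:Z) = fun k => (f k)%:Z.
Proof.
apply/funext => -[|k]; rewrite /diff big_ord_recr /= ?big_ord0; first by lia.
by set s := (\sum_(i < _) _)%N; lia.
Qed.

Lemma iter_diffD n f g : iter n diff (f \+ g) = iter n diff f \+ iter n diff g.
Proof. by elim: n => //= n ->; rewrite diffD. Qed.

Lemma iter_diff_shift n f : iter n diff (shift f) = shift (iter n diff f).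
Proof. by elim: n => //= n ->; rewrite diff_shift. Qed.

End BackwardDifference.

Section Counting.

Variable T : eqType.

(* The number of multisets of [k] points of [V] that avoid [av] and contain no two
   points [v], [q] with [nb v q] and [q] after [v] in [V]. *)
Fixpoint multiset_count (nb : rel T) (V : seq T) (av : pred T) (k : nat) : nat :=
  if V is v :: V' then
    multiset_count nb V' av k
    + (if av v then 0
       else \sum_(i < k) multiset_count nb V' (fun q => av q || nb v q) i)
  else k == 0.

(* The number of matchings with [k] edges, in the graph with edges [G], that avoid
   the vertices in [A]. *)
Fixpoint matching_count (G : seq (T * T)) (A : pred T) (k : nat) : nat :=
  if G is e :: G' then
    matching_count G' A k
    + (if A e.1 || A e.2 then 0
       else if k is k'.+1 then
         matching_count G' (fun x => A x || pred2 e.1 e.2 x) k' else 0)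
  else k == 0.

Definition forbids (R : seq ((T * T) * (T * T))) : rel T :=
  fun v q => has (fun u => u.1 == (v, q)) R.

Definition good_points (E : seq (T * (T * T))) (A : pred T) : pred T :=
  fun v => has (fun e => A e.1 && (e.2.1 == v)) E.

Arguments forbids : simpl never.
Arguments good_points : simpl never.

Definition strip_labels (E : seq (T * (T * T))) : seq T := undup (unzip1 E).

Lemma eq_multiset_count nb nb' V av av' k :
  {in V, av =1 av'} -> {in V &, nb =2 nb'} ->
  multiset_count nb V av k = multiset_count nb' V av' k.
Proof.
elim: V av av' k => //= v V IH av av' k eav enb.
have eav' : {in V, av =1 av'} by move=> x xV; apply: eav; rewrite inE xV orbT.
have enb' : {in V &, nb =2 nb'}.
  by move=> x y xV yV; apply: enb; rewrite inE ?xV ?yV orbT.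
rewrite (IH _ av') // eav ?mem_head //; congr (_ + _); case: ifP => // _.
apply: eq_bigr => i _; apply: IH => // q qV.
by rewrite eav' // enb // ?mem_head // inE qV orbT.
Qed.

Lemma eq_matching_count G A A' k :
  (forall e, e \in G -> A e.1 = A' e.1 /\ A e.2 = A' e.2) ->
  matching_count G A k = matching_count G A' k.
Proof.
elim: G A A' k => //= e G IH A A' k eA.
have eA' e' : e' \in G -> A e'.1 = A' e'.1 /\ A e'.2 = A' e'.2.
  by move=> e'G; apply: eA; rewrite inE e'G orbT.
have [-> ->] := eA e (mem_head _ _); rewrite (IH _ A') //; congr (_ + _).
case: ifP => // _; case: k => // k; apply: IH => e' /eA'[-> ->] //.
Qed.

Lemma good_pointsP E (A : pred T) v :
  reflect (exists S o, A S /\ (S, (v, o)) \in E) (good_points E A v).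
Proof.
apply: (iffP hasP) => [[[S [g o]] gE /= /andP[AS /eqP <-]]|[S [o [AS vE]]]].
  by exists S, o.
by exists (S, (v, o)) => //=; rewrite AS eqxx.
Qed.

Lemma forbidsP R v q :
  reflect (exists w, ((v, q), w) \in R) (forbids R v q).
Proof.
apply: (iffP hasP) => [[[e w] eR /= /eqP <-]|[w wR]]; first by exists w.
by exists ((v, q), w) => /=.
Qed.

Lemma strip_labels_attach V E R G S a b c d : grown V E R G ->
  (S, (a, b)) \in E -> c \notin V ->
  strip_labels (attach_edges S a b c d E) = c :: strip_labels E.
Proof.
move=> gr SE cV; rewrite /strip_labels /=.
have cE : c \notin unzip1 E.
  apply: contra cV => /mapP[[L [g o]] eE /= ->].
  by have [] := grown_mem gr eE.
have SE' : S \in unzip1 E by apply/mapP; exists (S, (a, b)).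
by rewrite !inE SE' eqxx !orbT (negPf cE).
Qed.

(** A point that is allowed and forbids nothing contributes a factor 1 / (1 - t). *)
Lemma diff_multiset_count nb v V av : ~~ av v -> {in V, nb v =1 xpred0} ->
  diff (fun k => Posz (multiset_count nb (v :: V) av k))
  = (fun k => Posz (multiset_count nb V av k)).
Proof.
move=> nav nbv; rewrite -[RHS]diff_sum; congr diff; apply/funext => k.
rewrite /= (negPf nav) big_ord_recr /= addnC; congr (Posz (_ + _)).
by apply: eq_bigr => i _; apply: eq_multiset_count => // q qV; rewrite nbv // orbF.
Qed.

Section Attach.

Variables (V : seq T) (E : seq (T * (T * T))) (R : seq ((T * T) * (T * T))).
Variables (G : seq (T * T)) (S a b c d : T).
Hypothesis gr : grown V E R G.
Hypotheses (cV : c \notin V) (dV : d \notin V) (ncd : c != d).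

Local Notation E' := (attach_edges S a b c d E).
Local Notation R' := (attach_rules S c d E R).

Lemma good_points_old (A : pred T) v : v \in V -> good_points E' A v = good_points E A v.
Proof.
move=> vV; apply/good_pointsP/good_pointsP => -[L [o [AL vE]]]; exists L, o.
  split=> //; case/attach_edgesP: vE => -[] // _ e _.
  - by case/negP: cV; rewrite -e.
  - by case/negP: cV; rewrite -e.
  - by case/negP: dV; rewrite -e.
by split=> //; have [_ _ _ ->] := mem_attach_edges S a b c d E.
Qed.

Lemma good_points_new (A : pred T) :
  good_points E' A c = A S || A c /\ good_points E' A d = A c.
Proof.
have [m1 m2 m3 m4] := mem_attach_edges S a b c d E.
split; apply/good_pointsP/idP => [[L [o [AL]]]|Ac].
- case/attach_edgesP=> [[<- _ _]|[<- _ _]|[_ /eqP e _]|cE]; rewrite ?AL ?orbT //.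
    by rewrite (negPf ncd) in e.
  by have [_ cV' _] := grown_mem gr cE; move: cV; rewrite cV'.
- by case/orP: Ac => Ac; [exists S, d|exists c, a].
- case/attach_edgesP=> [[_ /esym/eqP e _]|[_ /esym/eqP e _]|[<- //]|dE].
  + by rewrite (negPf ncd) in e.
  + by rewrite (negPf ncd) in e.
  by have [_ dV' _] := grown_mem gr dE; move: dV; rewrite dV'.
by exists c, b.
Qed.

Lemma forbids_old v q : v \in V -> forbids R' v q = forbids R v q.
Proof.
move=> vV; apply/forbidsP/forbidsP => -[w]; last first.
  by exists w; have [_ ->] := mem_attach_rules S c d E R.
case/attach_rulesP=> [[e _ [ev]]|wR]; last by exists w.
by case/negP: dV; rewrite -ev.
Qed.

Lemma forbids_c q : forbids R' c q = false.
Proof.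
apply/forbidsP => -[w /attach_rulesP[[e _ [/eqP]]|/(grown_rule_mem gr)[/= cV' _ _ _]]].
  by rewrite (negPf ncd).
by move: cV; rewrite cV'.
Qed.

Lemma forbids_d q : forbids R' d q = good_points E (pred1 S) q.
Proof.
apply/forbidsP/good_pointsP => [[w]|[L [o [/eqP-> qE]]]]; last first.
  by have [/(_ _ qE) r _] := mem_attach_rules S c d E R; exists (c, o).
case/attach_rulesP=> [[[g o] qE [-> _]]|/(grown_rule_mem gr)[/= dV' _ _ _]].
  by exists S, o; rewrite /= eqxx.
by move: dV; rewrite dV'.
Qed.

(** If [A c], both new points are excluded. If [A S], only [c] is, and the points that [d] forbids,
    the good ones of [S], are avoided already. Otherwise either [d] is absent and [c] is free, or
    [d] occurs k - i > 0 times, [c] is still free, and the old points must also avoid those good for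
    [S]. *)
Lemma multiset_count_attach (A : pred T) k :
  multiset_count (forbids R') [:: d, c & V] (good_points E' A) k =
  if A c then multiset_count (forbids R) V (good_points E A) k else
  if A S then \sum_(i < k.+1) multiset_count (forbids R) V (good_points E A) i else
    \sum_(i < k.+1) multiset_count (forbids R) V (good_points E A) i
    + \sum_(i < k) \sum_(j < i.+1)
        multiset_count (forbids R) V (good_points E [predU A & pred1 S]) j.
Proof.
set av := good_points E A.
have [gc gd] := good_points_new A.
have count av1 av2 j : {in V, av1 =1 av2} ->
    multiset_count (forbids R') V av1 j = multiset_count (forbids R) V av2 j.
  by move=> e; apply: eq_multiset_count => // x y xV _; apply: forbids_old.
have oldA : {in V, good_points E' A =1 av} by move=> v; apply: good_points_old.
rewrite /= gc gd; have [Ac|nAc] := ifPn (A c).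
  by rewrite orbT !addn0 (count _ av).
rewrite orbF (count _ av) // forbids_d.
have cS : good_points E (pred1 S) c = false.
  apply/good_pointsP => -[L [o [_ cE]]].
  by have [_ cV' _] := grown_mem gr cE; move: cV; rewrite cV'.
rewrite cS orbF; have [AS|nAS] := ifPn (A S).
  rewrite addn0 big_ord_recr /= addnC; congr (_ + _).
  apply: eq_bigr => i _; rewrite addn0; apply: count => v vV.
  rewrite forbids_d oldA //; apply: orb_idr => /good_pointsP[L [o [/eqP -> vE]]].
  by apply/good_pointsP; exists S, o.
rewrite big_ord_recr /= [X in X + _ = _]addnC; congr (_ + _ + _).
  by apply: eq_bigr => i _; apply: count => v vV; rewrite forbids_c orbF oldA.
apply: eq_bigr => i _; rewrite (negPf nAc) big_ord_recr /= addnC.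
have avS : {in V, (fun q => good_points E' A q || forbids R' d q) =1
    good_points E [predU A & pred1 S]}.
  move=> v vV /=; rewrite forbids_d oldA //.
  apply/orP/good_pointsP => [[] /good_pointsP[L [o [AL vE]]]|[L [o [/orP[AL|AL] vE]]]].
  - by exists L, o; split=> //; apply/orP; left.
  - by exists L, o; split=> //; apply/orP; right.
  - by left; apply/good_pointsP; exists L, o.
  by right; apply/good_pointsP; exists L, o.
congr (_ + _); last exact: count.
apply: eq_bigr => j _; apply: count => v vV.
by rewrite forbids_c orbF avS.
Qed.

End Attach.

(** The statement ranges over all [A] because the induction passes from [A] to [A] with [S]
    added. *)
Lemma grown_count V E R G (A : pred T) : grown V E R G ->
  iter (count (predC A) (strip_labels E)).+1 diff
    (fun k => Posz (multiset_count (forbids R) V (good_points E A) k))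
  = (fun k => Posz (matching_count G A k)).
Proof.
move=> gr; elim: gr A => [a b nab|V' E' R' G' S a b c d gr IH SE cV dV ncd] A.
  have gb : good_points [:: (a, (a, b))] A b = false.
    by rewrite /good_points /= (negPf nab) andbF.
  have ga : good_points [:: (a, (a, b))] A a = A a.
    by rewrite /good_points /= eqxx andbT orbF.
  have -> : count (predC A) (strip_labels [:: (a, (a, b))]) = ~~ A a.
    by rewrite /strip_labels /= addn0.
  have [Aa|nAa] := boolP (A a).
    rewrite -[iter _ _ _]/(diff _) diff_multiset_count ?gb //; apply/funext => k.
    by rewrite /= ga Aa addn0.
  by rewrite -[iter _ _ _]/(diff (diff _)) !diff_multiset_count ?gb ?ga.
rewrite (strip_labels_attach d gr SE cV); set L := strip_labels E'.
have -> : count (predC A) (c :: L) = ~~ A c + count (predC A) L by [].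
set N := multiset_count (forbids R') V'.
under eq_fun do rewrite (multiset_count_attach S a b gr cV dV ncd) -/N.
have [Ac|/negPf nAc] := boolP (A c).
  by rewrite add0n IH; apply/funext => k; rewrite /= Ac orbT addn0.
have [AS|/negPf nAS] := boolP (A S).
  rewrite add1n iterSr (diff_sum (N (good_points E' A))) IH.
  by apply/funext => k; rewrite /= AS addn0.
pose A' := [predU A & pred1 S].
have labS : S \in L by rewrite mem_undup; apply/mapP; exists (S, (a, b)).
have countA : count (predC A) L = (count (predC A') L).+1.
  rewrite !(seq.permP (perm_to_rem labS)) /A' /= nAS !inE eqxx orbT.
  congr _.+1; apply: eq_in_count => x; rewrite mem_rem_uniq ?undup_uniq // !inE /=.
  by case/andP=> /negPf ->; rewrite orbF.
pose f1 k := Posz (\sum_(i < k.+1) N (good_points E' A) i).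
pose f2 k := Posz (\sum_(i < k.+1) \sum_(j < i.+1) N (good_points E' A') j).
have -> : (fun k => Posz (\sum_(i < k.+1) N (good_points E' A) i +
    \sum_(i < k) \sum_(j < i.+1) N (good_points E' A') j)) = (f1 \+ shift f2)%R.
  by apply/funext => -[|k]; rewrite /f1 /GRing.add_fun //= big_ord0 addn0 addr0.
(* Two differences undo the double sum in [f2]. In [f1] one undoes the sum and the other is left
   over, which is the factor needed because one more strip lies outside [A] than outside [A']. *)
rewrite add1n countA -(addn2 _.+1) iterD -[iter 2 _ _]/(diff (diff _)).
rewrite (diffD f1) (diffD (diff f1)) (diff_shift f2) (diff_shift (diff f2)).
rewrite (diff_sum (fun i => \sum_(j < i.+1) N (good_points E' A') j)).
rewrite (diff_sum (N (good_points E' A'))) (diff_sum (N (good_points E' A))).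
rewrite iter_diffD iter_diff_shift IH -iterSr -countA IH.
apply/funext => k; rewrite /GRing.add_fun /= nAS nAc /=.
case: k => [|k] /=; rewrite ?addr0 ?addn0 // PoszD; congr (_ + Posz _)%R.
(* A matching using the new cell must avoid [S] and [c], but no older cell carries the fresh label
   [c]. *)
apply: eq_matching_count => -[L1 L2] /(grown_label_fresh gr)[/= L1V L2V].
have nc x : x \in V' -> (x == c) = false by move=> xV; apply: contraNF cV => /eqP <-.
by rewrite /A' !inE !nc // !orbF.
Qed.

End Counting.

Local Open Scope nat_scope.

(** * Standard monomials of a given degree as duplicate-free lists *)

Section MonomialLists.

Variables (T : eqType) (n : nat) (idx : T -> 'I_n).

Local Notation U p := (U_(idx p))%MM.

(** Runs along the recursion of [multiset_count], with exponent k - i > 0 on [v], so that the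
    lengths agree by construction. *)
Fixpoint monomials (nb : rel T) (V : seq T) (av : pred T) (k : nat) : seq 'X_{1..n} :=
  if V is v :: V' then
    monomials nb V' av k
    ++ (if av v then [::]
        else [seq (U v *+ (k - i) + m)%MM
             | i <- iota 0 k, m <- monomials nb V' (fun q => av q || nb v q) i])
  else if k == 0 then [:: 0%MM] else [::].

Definition avoids_pairs (nb : rel T) (V : seq T) (m : 'X_{1..n}) : bool :=
  pairwise (fun v q => nb v q ==> (m (idx v) == 0) || (m (idx q) == 0)) V.

Lemma size_monomials nb V (av : pred T) k : size (monomials nb V av k) = multiset_count nb V av k.
Proof.
elim: V av k => [|v V IH] av k /=; first by case: eqP.
rewrite size_cat IH; case: ifP => // _; rewrite size_allpairs_dep.
congr (_ + _); rewrite sumnE big_map -{1}[k]subn0 big_mkord.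
by apply: eq_bigr => i _.
Qed.

Lemma eq_avoids_pairs nb V (m m' : 'X_{1..n}) :
  (forall v, v \in V -> m (idx v) = m' (idx v)) ->
  avoids_pairs nb V m = avoids_pairs nb V m'.
Proof.
move=> e; apply: (@eq_in_pairwise _ (mem V)) (allss V) => x y xV yV /=.
by rewrite !e.
Qed.

Lemma monomialsP nb V (av : pred T) k m : uniq V -> {in V &, injective idx} ->
  reflect [/\ mdeg m = k, forall i, m i != 0 -> exists2 v, v \in V & i = idx v,
              forall v, v \in V -> av v -> m (idx v) = 0 & avoids_pairs nb V m]
          (m \in monomials nb V av k).
Proof.
elim: V av k m => [|v V IH] av k m /=.
  move=> _ _; apply: (iffP idP).
    by case: eqP => // ->; rewrite inE => /eqP->; split=> // [|i]; rewrite ?mdeg0 ?mnm0E.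
  case=> mk m0 _ _; have mE : m = 0%MM.
    apply/mnmP=> i; rewrite mnm0E; apply/eqP/negPn/negP=> /m0[] //.
  by rewrite -mk mE mdeg0 eqxx inE.
move=> /andP[vV uV] inj.
have injV : {in V &, injective idx}.
  by move=> x y xV yV; apply: inj; rewrite inE ?xV ?yV orbT.
have nv q : q \in V -> (idx v == idx q) = false.
  move=> qV; rewrite (inj_in_eq inj) ?inE ?qV ?eqxx ?orbT //.
  by apply: contraNF vV => /eqP->.
have supp_v m' : (forall i, m' i != 0 -> exists2 x, x \in V & i = idx x) -> m' (idx v) = 0.
  move=> supp; apply/eqP/negPn/negP => /supp[q /nv vq vE].
  by rewrite vE eqxx in vq.
have Uq j q : q \in V -> (U v *+ j)%MM (idx q) = 0.
  by move=> /nv vq; rewrite mulmnE mnm1E vq.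
have Uv j : (U v *+ j)%MM (idx v) = j by rewrite mulmnE mnm1E eqxx mul1n.
rewrite mem_cat; apply: (iffP orP) => [[/IH[//|//|mk supp avm prs]|]|].
- have mv := supp_v _ supp.
  split=> // [i /supp[q qV ->]|q|].
  + by exists q; rewrite // inE qV orbT.
  + by rewrite inE => /orP[/eqP->|/avm].
  rewrite /avoids_pairs /= [pairwise _ _]prs andbT.
  by apply/allP => q _; rewrite mv eqxx implybT.
- case: ifPn => // nav /allpairsPdep[i [m' [ik mi' ->]]].
  move: ik; rewrite mem_iota add0n /= => ik.
  have [mk supp avm prs] := IH _ _ _ uV injV mi'.
  have mv := supp_v _ supp.
  split=> [|j|q|].
  + by rewrite mdegD mdegMn mdeg1 mk; lia.
  + rewrite mnmDE; have [<-|nj] := eqVneq (idx v) j; first by exists v; rewrite ?mem_head.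
    rewrite mulmnE mnm1E (negPf nj) mul0n add0n => /supp[q qV ->].
    by exists q; rewrite // inE qV orbT.
  + rewrite inE => /orP[/eqP->|qV avq]; first by rewrite (negPf nav).
    by rewrite mnmDE Uq // avm // avq.
  rewrite /avoids_pairs /=; apply/andP; split.
    apply/allP => q qV; apply/implyP => vq; apply/orP; right.
    by rewrite mnmDE Uq // avm // vq orbT.
  rewrite -/(avoids_pairs _ _ _) (@eq_avoids_pairs _ _ _ m') // => q qV.
  by rewrite mnmDE Uq.
case=> mk supp avm /=; rewrite {1}/avoids_pairs /= => /andP[/allP vprs prs].
have [mv|mv] := eqVneq (m (idx v)) 0.
  left; apply/IH => //; split=> // [i mi|q qV].
    have [q] := supp i mi; rewrite inE => /orP[/eqP-> iE|]; last by exists q.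
    by rewrite iE mv eqxx in mi.
  by apply: avm; rewrite inE qV orbT.
right; have nav : av v = false.
  by apply/negP => /(avm _ (mem_head _ _))/eqP; rewrite (negPf mv).
have mvk : m (idx v) <= k by rewrite -mk mdegE (bigD1 (idx v)) //= leq_addr.
pose m' := (m - U v *+ m (idx v))%MM.
have mE : m = (U v *+ m (idx v) + m')%MM.
  apply/mnmP=> i; rewrite mnmDE mnmBE mulmnE mnm1E.
  by have [<-|_] := eqVneq (idx v) i; lia.
have m'v : m' (idx v) = 0 by rewrite mnmBE Uv subnn.
have m'V q : q \in V -> m' (idx q) = m (idx q) by move=> qV; rewrite mnmBE Uq ?subn0.
rewrite nav; apply/allpairsPdep; exists (k - m (idx v)), m'; split.
- by rewrite mem_iota add0n /=; move: mv; rewrite -lt0n; lia.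
- apply/IH => //; split=> [|i m'i|q qV|].
  + by move: mk; rewrite {1}mE mdegD mdegMn mdeg1; lia.
  + have [|q] := supp i; first by apply: contraNneq m'i; rewrite mnmBE => ->.
    rewrite inE => /orP[/eqP-> iE|]; last by exists q.
    by rewrite iE m'v eqxx in m'i.
  + rewrite m'V // => /orP[|vq]; first by apply: avm; rewrite inE qV orbT.
    by have := vprs _ qV; rewrite vq (negPf mv) => /eqP.
  by rewrite (@eq_avoids_pairs _ _ _ m).
by rewrite subKn.
Qed.

Lemma monomials_uniq nb V av k : uniq V -> {in V &, injective idx} ->
  uniq (monomials nb V av k).
Proof.
elim: V av k => [|v V IH] av k /=; first by case: eqP.
move=> /andP[vV uV] inj.
have injV : {in V &, injective idx}.
  by move=> x y xV yV; apply: inj; rewrite inE ?xV ?yV orbT.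
have mon_v av' j m : m \in monomials nb V av' j -> m (idx v) = 0.
  case/(monomialsP _ _ _ _ uV injV) => _ supp _ _.
  apply/eqP/negPn/negP => /supp[q qV vq]; case/negP: vV.
  by rewrite (inj v q) // inE ?eqxx ?qV ?orbT.
have Uv j : (U v *+ j)%MM (idx v) = j by rewrite mulmnE mnm1E eqxx mul1n.
rewrite cat_uniq IH //=; case: ifP => // _; apply/andP; split.
  apply/hasPn => m /allpairsPdep[i [m' [ik /mon_v m'v mE]]].
  apply: contraTN ik => /mon_v; rewrite mE mnmDE Uv m'v mem_iota; lia.
apply: allpairs_uniq_dep => [|i _|]; rewrite ?iota_uniq ?IH //.
move=> _ _ /allpairsPdep[i [m1 [ik /mon_v m1v ->]]] /allpairsPdep[j [m2 [jk /mon_v m2v ->]]] /= e.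
have ij : i = j.
  move/mnmP/(_ (idx v)): e; move: ik jk.
  by rewrite !mnmDE !Uv m1v m2v !mem_iota; lia.
by move: e; rewrite ij => /addmI ->.
Qed.

End MonomialLists.

Section StandardMonomials.

Variables (T : eqType) (n : nat) (idx : T -> 'I_n).

(** The counting checks a point only against those after it in [V]; this order ensures that it sees
    every rule. *)
Lemma grown_rule_order (V : seq T) E R G u : grown V E R G -> u \in R ->
  subseq [:: u.1.1; u.1.2] V.
Proof.
move=> gr; elim: gr u => // V' E' R' G' S a b c d gr IH SE cV dV ncd u.
case/attach_rulesP=> [[[g o] gE ->] /=|/IH sub]; last first.
  exact: subseq_trans sub (subseq_trans (subseq_cons _ c) (subseq_cons _ d)).
rewrite eqxx; have [_ gV _] := grown_mem gr gE.
by case: ifP => _; rewrite ?sub0seq ?sub1seq.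
Qed.

Lemma irreducible_avoids_pairs (V : seq T) E R G (m : 'X_{1..n}) : grown V E R G ->
  irreducible idx R m = avoids_pairs idx (forbids R) V m.
Proof.
move=> gr; apply/allP/idP => [irr|].
  rewrite /avoids_pairs; apply: sub_pairwise (_ : pairwise (fun _ _ => true) V).
    move=> p q _; apply/implyP => /forbidsP[w wR]; exact: irr wR.
  by elim: (V) => //= v V' ->; rewrite andbT; apply/allP.
move=> avp [[p q] w] uR; have sub := grown_rule_order gr uR.
have := subseq_pairwise sub avp; rewrite pairwise2 => /implyP; apply.
by apply/forbidsP; exists w.
Qed.

Lemma standard_monomialsP (V : seq T) E R G k (m : 'X_{1..n}) :
  grown V E R G -> {in V &, injective idx} ->
  (forall i, exists2 v, v \in V & i = idx v) ->
  (m \in monomials idx (forbids R) V pred0 k) = (mdeg m == k) && irreducible idx R m.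
Proof.
move=> gr inj surj; rewrite (irreducible_avoids_pairs _ gr).
apply/monomialsP/andP => [|||[/eqP mk avp]] //; first exact: grown_uniq gr.
  by case=> /eqP mk _ _ avp.
Qed.

End StandardMonomials.

(** * Hilbert functions from normal forms *)

Local Open Scope ring_scope.

(** Expressing each basis in the other gives matrices whose product is the identity of size [n] and
    factors through size [m]. *)
Lemma has_dimension_le (K : fieldType) (V : lmodType K) (W : V -> Prop) n m :
  has_dimension W n -> has_dimension W m -> (n <= m)%N.
Proof.
move=> [b [Wb bP]] [b' [Wb' b'P]].
have /choice[c cP] i : exists c : {ffun 'I_m -> K}, b i = \sum_j c j *: b' j.
  by have [c [? _]] := b'P _ (Wb i); exists c.
have /choice[c' c'P] j : exists c : {ffun 'I_n -> K}, b' j = \sum_i c i *: b i.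
  by have [c' [? _]] := bP _ (Wb' j); exists c'.
apply: (@mulmx1_min K n m (\matrix_(i, j) c i j) (\matrix_(j, l) c' j l)).
apply/matrixP=> i l; rewrite !mxE.
have [e [_ eU]] := bP _ (Wb i).
pose e1 := [ffun l => \sum_j c i j * c' j l]; pose e2 := [ffun l => (i == l)%:R : K].
have e1E : e = e1.
  apply: eU; rewrite [LHS]cP; under eq_bigr do rewrite c'P scaler_sumr.
  rewrite exchange_big; apply: eq_bigr => l' _; rewrite ffunE scaler_suml.
  by apply: eq_bigr => j _; rewrite scalerA.
have e2E : e = e2.
  apply: eU; rewrite (bigD1 i) //= ffunE eqxx scale1r big1 ?addr0 // => l' nl'.
  by rewrite ffunE eq_sym (negPf nl') scale0r.
transitivity (e1 l); first by rewrite ffunE; apply: eq_bigr => j _; rewrite !mxE.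
by rewrite -e1E e2E ffunE.
Qed.

Lemma hilbert_functionE (K : fieldType) (P : {fset cell}) k N :
  has_dimension (@homogeneous_part K P k) N -> hilbert_function K P k = N.
Proof.
rewrite /hilbert_function; case: cid => m /= mP NP.
by apply/eqP; rewrite eqn_leq !(has_dimension_le mP NP, has_dimension_le NP mP).
Qed.

Section NormalForms.

Variables (K : fieldType) (P : {fset cell}) (k : nat).

Local Notation n := #|{: vertices P}|.

Variables (nf : 'X_{1..n} -> 'X_{1..n}) (s : seq 'X_{1..n}).
Hypothesis s_uniq : uniq s.
Hypothesis sP : forall m, (m \in s) = (mdeg m == k) && (nf m == m).
Hypothesis nf_deg : forall m, mdeg (nf m) = mdeg m.
Hypothesis nf_idem : forall m, nf (nf m) = nf m.
Hypothesis nf_eq : forall m, @to_algebra K P 'X_[m] = to_algebra 'X_[nf m].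
Hypothesis nf_binomial : forall f, @polyomino_binomial K P f ->
  exists m1 m2, f = 'X_[m1] - 'X_[m2] /\ forall r, nf (r + m1)%MM = nf (r + m2)%MM.

(** The coefficient of [x] in the normal form of [f], for [x] of degree [k]. *)
Definition class_sum (x : 'X_{1..n}) (f : polyomino_ring K P) : K :=
  \sum_(m : 'X_{1..n < k.+1} | nf m == x) f@_m.

Lemma class_sumD x f g : class_sum x (f + g) = class_sum x f + class_sum x g.
Proof. by rewrite -big_split; apply: eq_bigr => m _; rewrite mcoeffD. Qed.

Lemma class_sum0 x : class_sum x 0 = 0.
Proof. by rewrite /class_sum big1 // => m _; rewrite mcoeff0. Qed.

Lemma class_sumZ x a f : class_sum x (a *: f) = a * class_sum x f.
Proof. by rewrite mulr_sumr; apply: eq_bigr => m _; rewrite mcoeffZ. Qed.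

Lemma class_sum_sum x (I : Type) (r : seq I) (F : I -> polyomino_ring K P) :
  class_sum x (\sum_(i <- r) F i) = \sum_(i <- r) class_sum x (F i).
Proof.
by elim/big_rec2: _ => [|i y f _ <-]; rewrite ?class_sum0 ?class_sumD.
Qed.

Lemma class_sumX x m : x \in s -> class_sum x 'X_[m] = (nf m == x)%:R.
Proof.
rewrite sP => /andP[/eqP xk _]; rewrite /class_sum; under eq_bigr do rewrite mcoeffX.
have [nm|nm] := eqVneq (nf m) x; last first.
  rewrite big1 // => m' /eqP nm'; case: eqP => // mm'.
  by rewrite mm' nm' eqxx in nm.
have mk : (mdeg m < k.+1)%N by rewrite -nf_deg nm xk.
rewrite (bigD1 (BMultinom mk)) /= ?nm ?eqxx //= big1 ?addr0 // => m' /andP[_].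
by rewrite bmeqP eq_sym => /negPf ->.
Qed.

(** A monomial multiple of a generator is a difference of two monomials with one normal form. The
    degree bound in [class_sum] loses nothing: [nf] keeps degrees, so the class of [x] lies in
    degree [k]. *)
Lemma class_sum_ideal x f : x \in s -> f \in @polyomino_ideal K P -> class_sum x f = 0.
Proof.
move=> xs /asboolP[r [rG ->]]; rewrite class_sum_sum big_seq big1 // => q.
move=> /rG /nf_binomial[m1 [m2 [-> nfE]]].
rewrite [q.1]mpolyE mulr_suml class_sum_sum big1 // => m _.
rewrite -scalerAl class_sumZ mulrBr -!mpolyXD -scaleN1r class_sumD class_sumZ.
by rewrite !class_sumX // nfE mulN1r subrr mulr0.
Qed.

Lemma to_algebraZ a f : a *: @to_algebra K P f = to_algebra (a *: f).
Proof. by rewrite -mul_mpolyC rmorphM. Qed.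

(** The monomials of [s] span by [nf_eq]; the functionals [class_sum], dual to them and zero on the
    ideal, determine the coordinates. *)
Lemma normal_form_dimension : has_dimension (@homogeneous_part K P k) (size s).
Proof.
pose x i := tnth (in_tuple s) i.
have xs i : x i \in s by apply: mem_tnth.
have x_eq i j : (x i == x j) = (i == j).
  by rewrite /x !(tnth_nth 0%MM) nth_uniq ?ltn_ord.
exists (fun i => to_algebra 'X_[x i]); split=> [i|_ [f fk ->]].
  exists 'X_[x i] => //; rewrite dhomogX.
  by have := xs i; rewrite sP => /andP[].
have sumE (c : {ffun 'I_(size s) -> K}) :
    \sum_i c i *: to_algebra 'X_[x i] = @to_algebra K P (\sum_i c i *: 'X_[x i]).
  by rewrite rmorph_sum; apply: eq_bigr => i _; rewrite to_algebraZ.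
exists [ffun i => class_sum (x i) f]; split.
  have -> : @to_algebra K P f =
      \sum_(m <- msupp f) \sum_i (f@_m * (nf m == x i)%:R) *: to_algebra 'X_[x i].
    rewrite {1}[f]mpolyE rmorph_sum big_seq [RHS]big_seq; apply: eq_bigr => m mf.
    have nfs : nf m \in s by rewrite sP nf_deg nf_idem eqxx andbT (dhomog_mf fk mf).
    have /tnthP[i iE] : nf m \in in_tuple s by [].
    rewrite /= -to_algebraZ nf_eq iE -/(x i) (bigD1 i) //= eqxx mulr1.
    by rewrite big1 ?addr0 // => j nj; rewrite x_eq eq_sym (negPf nj) mulr0 scale0r.
  rewrite exchange_big; apply: eq_bigr => i _; rewrite ffunE -scaler_suml.
  congr (_ *: _); rewrite [in RHS](mpolyE f) class_sum_sum; apply: eq_bigr => m _.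
  by rewrite class_sumZ class_sumX.
move=> c; rewrite sumE => e; apply/ffunP => i; rewrite ffunE.
have fI : f - \sum_i c i *: 'X_[x i] \in @polyomino_ideal K P.
  by rewrite Quotient.idealrBE; apply/eqP.
have /eqP := class_sum_ideal (xs i) fI.
rewrite -scaleN1r class_sumD class_sumZ mulN1r subr_eq0 => /eqP ->.
have nfx j : nf (x j) = x j by have := xs j; rewrite sP => /andP[_ /eqP].
rewrite class_sum_sum (bigD1 i) //= class_sumZ class_sumX // nfx eqxx mulr1.
rewrite big1 ?addr0 // => j nj.
by rewrite class_sumZ class_sumX // nfx x_eq (negPf nj) mulr0.
Qed.

End NormalForms.

Section StripPresentation.

Variables (K : fieldType) (P : {fset cell}) (T : eqType).

Local Notation n := #|{: vertices P}|.

Variables (idx : T -> 'I_n) (V : seq T) (E : seq (T * (T * T))).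
Variables (R : seq ((T * T) * (T * T))) (G : seq (T * T)).

Definition strip_binomial (e e' : T * T) : polyomino_ring K P :=
  'X_(idx e.1) * 'X_(idx e'.2) - 'X_(idx e'.1) * 'X_(idx e.2).

Hypothesis gr : grown V E R G.
Hypothesis inj : {in V &, injective idx}.
Hypothesis surj : forall i, exists2 v, v \in V & i = idx v.
Hypothesis binomial_strip : forall f, @polyomino_binomial K P f ->
  exists S e e', [/\ (S, e) \in E, (S, e') \in E & f = strip_binomial e e'].
Hypothesis strip_ideal : forall S e e', (S, e) \in E -> (S, e') \in E ->
  strip_binomial e e' \in @polyomino_ideal K P.

Lemma reduces_mdeg m m' : reduces idx R m m' -> mdeg m' = mdeg m.
Proof.
by elim=> // m1 m2 m3 [u _ [r [-> ->]]] _ ->; rewrite !mdegD !mdeg1.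
Qed.

Lemma to_algebra_reduces m m' :
  reduces idx R m m' -> @to_algebra K P 'X_[m] = to_algebra 'X_[m'].
Proof.
elim=> // m1 m2 m3 [[[p q] [y z]] uR [r [-> ->]]] _ <-.
have [_ [S [eS eS']]] := grown_rule gr uR.
apply/eqP; rewrite -Quotient.idealrBE !mpolyXD -mulrBl mulrC idealMr //.
have := strip_ideal eS' eS; rewrite /strip_binomial /= => /(idealMr (-1)).
by rewrite mulN1r opprB mulrC.
Qed.

Lemma grown_hilbert_function k :
  hilbert_function K P k = multiset_count (forbids R) V xpred0 k.
Proof.
have [nf [nf_red nf_irr nf_id nf_join]] := grown_normal_form gr inj.
apply: hilbert_functionE; rewrite -(size_monomials idx).
apply: (@normal_form_dimension _ _ _ nf) => [|m|m|m|m|f].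
- exact: monomials_uniq (grown_uniq gr) inj.
- rewrite (standard_monomialsP _ _ gr inj surj); congr (_ && _).
  by apply/idP/eqP => [/nf_id|<-].
- exact: reduces_mdeg (nf_red m).
- exact: nf_id.
- exact: to_algebra_reduces (nf_red m).
move=> /binomial_strip[S [[g o] [[g' o'] [eE eE' ->]]]].
exists (U_(idx g) + U_(idx o'))%MM, (U_(idx g') + U_(idx o))%MM.
rewrite !mpolyXD; split=> // r; apply: nf_join; rewrite ![(r + _)%MM]addmC.
by apply: joinable_add; apply: grown_related gr eE eE'.
Qed.

End StripPresentation.

Lemma sum_one_subX_expr (f : nat -> int) d k :
  \sum_(i < k.+1) f i * ((1 - 'X : {poly int}) ^+ d)`_(k - i) = iter d diff f k.
Proof.
elim: d k => [|d IH] k.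
  rewrite big_ord_recr /= subnn expr0 coef1 mulr1 big1 ?add0r // => i _.
  by rewrite coef1; case: (k - i)%N (subn_gt0 i k) => [|j]; rewrite ?ltn_ord // mulr0.
rewrite iterS /diff -!IH exprSr.
under eq_bigr do rewrite mulrBr mulr1 coefB mulrBr coefMX.
rewrite sumrB; congr (_ - _); case: k => [|k]; first by rewrite big_ord1 mulr0.
rewrite big_ord_recr /= subnn mulr0 addr0 -IH; apply: eq_bigr => i _.
by rewrite subSn ?(ltnW (ltn_ord i)) //; rewrite -ltnS.
Qed.

Lemma iter_diff_coef (p : {poly int}) d k :
  iter d diff (fun i => p`_i) k = (p * (1 - 'X) ^+ d)`_k.
Proof.
elim: d k => [|d IH] k /=; first by rewrite expr0 mulr1.
rewrite exprSr mulrA mulrBr mulr1 coefB coefMX /diff IH.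
by case: k => // k; rewrite IH.
Qed.

(* If [h = (1 - t)^e r] with [e > 0] then [h] vanishes at 1. *)
Lemma hilbert_numerator_unique (f : nat -> int) (h r : {poly int}) d d' :
  h.[1] != 0 -> r.[1] != 0 ->
  (forall k, iter d diff f k = h`_k) -> (forall k, iter d' diff f k = r`_k) -> h = r.
Proof.
wlog le_dd' : h r d d' / (d <= d')%N => [hwlog|h1 r1 hE rE].
  by case: (leqP d d') => [|/ltnW] le h1 r1 hE rE; [|symmetry];
    apply: (hwlog _ _ _ _ le).
have rh : r = h * (1 - 'X) ^+ (d' - d).
  apply/polyP => k; rewrite -rE -iter_diff_coef -(subnK le_dd') iterD subnK //.
  by rewrite (funext hE).
move: r1; rewrite rh; case: (d' - d)%N => [|e]; first by rewrite expr0 mulr1.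
by rewrite exprS mulrCA hornerM hornerD hornerN hornerX -polyC1 hornerC subrr mul0r eqxx.
Qed.

(** * Winding numbers of closed walks of cells *)

Local Open Scope nat_scope.

(** Sharing a side, in coordinates; [edge_adjacentW] carries the connecting paths over to this
    relation. *)
Definition adjacent : rel cell := fun C D =>
  (C.1 == D.1) && ((C.2 == D.2.+1) || (D.2 == C.2.+1))
  || (C.2 == D.2) && ((C.1 == D.1.+1) || (D.1 == C.1.+1)).

Lemma mem_cell_vertices (C : cell) (p : point) :
  (p \in cell_vertices C) = (C.1 <= p.1 <= C.1.+1) && (C.2 <= p.2 <= C.2.+1).
Proof.
have between a b : (a <= b <= a.+1) = (b == a) || (b == a.+1) by lia.
case: C p => [i j] [x y]; rewrite !between !inE !xpair_eqE /=.
by case: (x == i); case: (x == i.+1); case: (y == j); case: (y == j.+1).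
Qed.

Lemma edge_adjacentW : subrel edge_adjacent adjacent.
Proof.
move=> [i j] [k l]; rewrite /edge_adjacent /adjacent.
set V := (_ `&` _)%fset.
have VP p : p \in cell_vertices (i, j) -> (p \in V) = (p \in cell_vertices (k, l)).
  by move=> pC; rewrite inE pC.
(* Only the four corners of (i, j) can lie in [V]; for each candidate edge their membership becomes
   a set of linear conditions on [k] and [l]. *)
have corner a b : a <= 1 -> b <= 1 ->
    ((i + a, j + b) \in V) = (k <= i + a <= k.+1) && (l <= j + b <= l.+1).
  by move=> a1 b1; rewrite VP mem_cell_vertices //=; lia.
have := corner 0 0 isT isT; have := corner 1 0 isT isT.
have := corner 0 1 isT isT; have := corner 1 1 isT isT.
clearbody V => {VP corner}; rewrite !addn0 !addn1 /=.
have neqS x : (x == x.+1) = false by lia.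
have neSq x : (x.+1 == x) = false by lia.
rewrite !inE => h11 h01 h10 h00 /or4P[] /eqP VE; move: h11 h01 h10 h00;
  rewrite VE !inE !xpair_eqE !eqxx ?neqS ?neSq /=; clear; lia.
Qed.

Lemma adjacent_sym C D : adjacent C D = adjacent D C.
Proof.
rewrite /adjacent [C.1 == D.1]eq_sym [C.2 == D.2]eq_sym.
by congr ((_ && _) || (_ && _)); apply: orbC.
Qed.

Lemma adjacentP C D : reflect
  [\/ D = (C.1.+1, C.2), C = (D.1.+1, D.2), D = (C.1, C.2.+1) | C = (D.1, D.2.+1)]
  (adjacent C D).
Proof.
case: C D => [i j] [k l]; rewrite /adjacent /=; apply: (iffP idP); last first.
  by case=> -[-> ->]; rewrite !eqxx ?orbT.
by case/orP=> /andP[/eqP -> /orP[] /eqP ->];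
  [constructor 4|constructor 3|constructor 2|constructor 1].
Qed.

Section Walks.

Fixpoint walk_sum (f : cell -> cell -> bool) (C : cell) (s : seq cell) : bool :=
  if s is D :: s' then f C D (+) walk_sum f D s' else false.

(* [crossing p] selects the vertical steps crossing the horizontal half-line
   that starts at [p] and goes left; its sum along a closed walk is the winding
   number of the walk around [p] modulo 2. *)
Definition crossing (p : point) (C D : cell) : bool :=
  [&& C.1 == D.1, maxn C.2 D.2 == p.2 & C.1 < p.1].

(** Selects the steps across the unit edge from [p] to p + (1, 0), as [crosses_up] does for the edge
    from [p] to p + (0, 1). Their parity is the change of the winding number when the point moves
    along that edge. *)
Definition crosses_right (p : point) (C D : cell) : bool :=
  [&& C.1 == D.1, maxn C.2 D.2 == p.2 & C.1 == p.1].

Definition crosses_up (p : point) (C D : cell) : bool :=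
  [&& C.2 == D.2, maxn C.1 D.1 == p.1 & C.2 == p.2].

Lemma walk_sum_rcons f C s D :
  walk_sum f C (rcons s D) = walk_sum f C s (+) f (last C s) D.
Proof. by elim: s C => [|B s IH] C /=; rewrite ?addbF // IH addbA. Qed.

Lemma walk_sum_eq f g C s :
  (forall A B, A \in C :: s -> B \in C :: s -> adjacent A B -> f A B = g A B) ->
  path adjacent C s -> walk_sum f C s = walk_sum g C s.
Proof.
elim: s C => //= B s IH C fg /andP[CB ps].
rewrite fg ?inE ?eqxx ?orbT // IH // => A D As Ds.
by apply: fg; rewrite inE ?As ?Ds orbT.
Qed.

Lemma walk_sum_add f g C s :
  walk_sum (fun A B => f A B (+) g A B) C s = walk_sum f C s (+) walk_sum g C s.
Proof.
by elim: s C => //= B s IH C; rewrite IH; lia.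
Qed.

Lemma walk_sum_boundary (g : pred cell) C s :
  walk_sum (fun A B => g A (+) g B) C s = g C (+) g (last C s).
Proof. by elim: s C => [|B s IH] C /=; rewrite ?addbb // IH; lia. Qed.

Lemma walk_sum_crosses_right C s x y :
  walk_sum (crossing (x.+1, y)) C s
  = walk_sum (crossing (x, y)) C s (+) walk_sum (crosses_right (x, y)) C s.
Proof.
rewrite -walk_sum_add; elim: s C => //= B s IH C; rewrite IH.
by congr (_ (+) _); rewrite /crossing /crosses_right /=; lia.
Qed.

(** The half-lines ending at (x, y) and (x, y + 1), with the edge between these points, bound the
    half-strip [g] of cells; a closed walk crosses this boundary an even number of times. *)
Lemma walk_sum_crosses_up C s x y : path adjacent C s -> last C s = C ->
  walk_sum (crossing (x, y.+1)) C s
  = walk_sum (crossing (x, y)) C s (+) walk_sum (crosses_up (x, y)) C s.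
Proof.
move=> ps closed; pose g (A : cell) := (A.1 < x) && (A.2 == y).
have b0 := walk_sum_boundary g C s; rewrite closed addbb in b0.
rewrite -[LHS]addbF -b0 -!walk_sum_add.
apply: walk_sum_eq ps => A B _ _.
case/adjacentP=> ->; rewrite /crossing /crosses_up /g /= eqxx.
- rewrite [maxn _ _](maxn_idPr _) // (ltn_eqF (ltnSn _)) /=.
  by case: (A.2 == y); rewrite ?andbF ?andbT //=; clear; lia.
- rewrite [maxn _ _](maxn_idPl _) // (gtn_eqF (ltnSn _)) /=.
  by case: (B.2 == y); rewrite ?andbF ?andbT //=; clear; lia.
- rewrite [maxn _ _](maxn_idPr _) // (ltn_eqF (ltnSn _)) /= eqSS.
  by case: (A.1 < x); case: (A.2 == y); case: (A.2.+1 == y).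
rewrite [maxn _ _](maxn_idPl _) // (gtn_eqF (ltnSn _)) /= eqSS.
by case: (B.1 < x); case: (B.2 == y); case: (B.2.+1 == y).
Qed.

Lemma crossing_left y C D : crossing (0, y) C D = false.
Proof. by rewrite /crossing ltn0 !andbF. Qed.

Lemma crossing_bottom x C D : adjacent C D -> crossing (x, 0) C D = false.
Proof.
by case/adjacentP=> ->; rewrite /crossing /=; apply/negP => /and3P[/eqP]; lia.
Qed.

Lemma crosses_right_mem p C D : adjacent C D -> crosses_right p C D ->
  0 < p.2 /\ (C = p /\ D = (p.1, p.2.-1) \/ D = p /\ C = (p.1, p.2.-1)).
Proof.
case: p => x y /adjacentP[] ->; rewrite /crosses_right /= => /and3P[/eqP e1 /eqP e2 /eqP e3].
- lia.
- lia.
- by rewrite -e2 (maxn_idPr _) //=; split=> //; right; rewrite -e3; case: (C).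
by rewrite -e2 (maxn_idPl _) //=; split=> //; left; rewrite -e3; case: (D).
Qed.

Lemma crosses_up_mem p C D : adjacent C D -> crosses_up p C D ->
  0 < p.1 /\ (C = p /\ D = (p.1.-1, p.2) \/ D = p /\ C = (p.1.-1, p.2)).
Proof.
case: p => x y /adjacentP[] ->; rewrite /crosses_up /= => /and3P[/eqP e1 /eqP e2 /eqP e3].
- by rewrite -e2 (maxn_idPr _) //=; split=> //; right; rewrite -e3; case: (C).
- by rewrite -e2 (maxn_idPl _) //=; split=> //; left; rewrite -e3; case: (D).
- lia.
lia.
Qed.

End Walks.

Lemma walk_sum_none f C s : path adjacent C s ->
  (forall A B, A \in C :: s -> B \in C :: s -> adjacent A B -> f A B = false) ->
  walk_sum f C s = false.
Proof.
move=> ps f0; rewrite (walk_sum_eq (g := fun _ _ => false) f0 ps).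
by elim: (s) (C) => //= B s' ->.
Qed.

Lemma edge_connectedW (Q : pred cell) C D : edge_connected Q -> Q C -> Q D ->
  exists s, [/\ path adjacent C s, all Q s & last C s = D].
Proof.
move=> cQ QC QD; have [s /andP[ps Qs] sD] := cQ _ _ QC QD.
by exists s; split=> //; apply: sub_path ps; apply: edge_adjacentW.
Qed.

Section Loop.

Variables (P : {fset cell}) (Z X Y : cell) (s : seq cell).
Hypotheses (ZX : adjacent Z X) (YZ : adjacent Y Z).
Hypotheses (ps : path adjacent X s) (ls : last X s = Y).
Hypothesis sP : {subset X :: s <= P}.

Local Notation loop_sum f := (walk_sum f Z (X :: rcons s Z)).
Local Notation winding p := (loop_sum (crossing p)).

Let ploop : path adjacent Z (X :: rcons s Z).
Proof. by rewrite /= ZX rcons_path ps ls YZ. Qed.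

Let lloop : last Z (X :: rcons s Z) = Z.
Proof. by rewrite /= last_rcons. Qed.

Lemma loop_sumE f : loop_sum f = f Z X (+) (walk_sum f X s (+) f Y Z).
Proof. by rewrite /= walk_sum_rcons ls. Qed.

Lemma winding_right x y :
  winding (x.+1, y) = winding (x, y) (+) loop_sum (crosses_right (x, y)).
Proof. exact: walk_sum_crosses_right. Qed.

Lemma winding_up x y :
  winding (x, y.+1) = winding (x, y) (+) loop_sum (crosses_up (x, y)).
Proof. exact: walk_sum_crosses_up ploop lloop. Qed.

Lemma crosses_right_none p : p \notin X :: s \/ (p.1, p.2.-1) \notin X :: s ->
  walk_sum (crosses_right p) X s = false.
Proof.
move=> np; apply: walk_sum_none ps _ => A B As Bs AB; apply/negP.
move/(crosses_right_mem AB) => [_ [[Ap Bp]|[Bp Ap]]]; rewrite Ap Bp in As Bs;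
  by case: np => /negP; apply.
Qed.

Lemma crosses_up_none p : p \notin X :: s \/ (p.1.-1, p.2) \notin X :: s ->
  walk_sum (crosses_up p) X s = false.
Proof.
move=> np; apply: walk_sum_none ps _ => A B As Bs AB; apply/negP.
move/(crosses_up_mem AB) => [_ [[Ap Bp]|[Bp Ap]]]; rewrite Ap Bp in As Bs;
  by case: np => /negP; apply.
Qed.

Lemma winding_left y : winding (0, y) = false.
Proof.
by apply: walk_sum_none ploop _ => A B _ _ _; apply: crossing_left.
Qed.

Lemma winding_bottom x : winding (x, 0) = false.
Proof.
by apply: walk_sum_none ploop _ => A B _ _; apply: crossing_bottom.
Qed.

Lemma notin_walk W : W \notin P -> W \notin X :: s.
Proof. by apply: contra => /sP. Qed.

(** Each cell stands for its lower left corner. Between neighbouring cells this corner moves along a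
    side of one of them, and the part of the loop inside [P] cannot cross a side of a cell outside
    [P]. Since [Z] may lie outside [P], its two steps are handled by separate hypotheses. *)
Lemma winding_constant W t :
  (forall W, W \notin P -> (W.1.+1, W.2) \notin P ->
     ~~ crosses_right W Z X /\ ~~ crosses_right W Y Z) ->
  (forall W, W \notin P -> (W.1, W.2.+1) \notin P ->
     ~~ crosses_up W Z X /\ ~~ crosses_up W Y Z) ->
  path adjacent W t -> all (fun C => C \notin P) (W :: t) ->
  winding (last W t) = winding W.
Proof.
move=> cr cu.
have right A : A \notin P -> (A.1.+1, A.2) \notin P -> winding (A.1.+1, A.2) = winding A.
  case: A => x y nA nA'; have [c1 c2] := cr _ nA nA'.
  rewrite winding_right (loop_sumE (crosses_right _)) (negPf c1) (negPf c2).
  by rewrite crosses_right_none ?addbF //; left; apply: notin_walk.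
have up A : A \notin P -> (A.1, A.2.+1) \notin P -> winding (A.1, A.2.+1) = winding A.
  case: A => x y nA nA'; have [c1 c2] := cu _ nA nA'.
  rewrite winding_up (loop_sumE (crosses_up _)) (negPf c1) (negPf c2).
  by rewrite crosses_up_none ?addbF //; left; apply: notin_walk.
elim: t W => // A t IH W /andP[WA pt] /andP[nW nAt].
have [nA _] := andP nAt.
rewrite [last _ _]/(last A t) IH //; case/adjacentP: WA nW nA => e nW nA.
- by rewrite e right // -e.
- by rewrite e right // -e.
- by rewrite e up // -e.
by rewrite e up // -e.
Qed.

End Loop.

Section SimplePolyomino.

Variable P : {fset cell}.
Hypothesis simpleP : is_simple P.

Lemma winding_simple Z X Y s W W' :
  adjacent Z X -> adjacent Y Z -> path adjacent X s -> last X s = Y ->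
  {subset X :: s <= P} ->
  (forall W, W \notin P -> (W.1.+1, W.2) \notin P ->
     ~~ crosses_right W Z X /\ ~~ crosses_right W Y Z) ->
  (forall W, W \notin P -> (W.1, W.2.+1) \notin P ->
     ~~ crosses_up W Z X /\ ~~ crosses_up W Y Z) ->
  W \notin P -> W' \notin P ->
  walk_sum (crossing W) Z (X :: rcons s Z) = walk_sum (crossing W') Z (X :: rcons s Z).
Proof.
move=> ZX YZ ps ls sP cr cu nW nW'.
have [t [pt nt <-]] := edge_connectedW simpleP nW nW'.
by rewrite (winding_constant ZX YZ ps ls sP cr cu pt) //= nW.
Qed.

(* A closed walk through [Z] traverses the edge between [Z] and [X] once, so one
   end point of that edge has odd winding number.  By thinness some cell around
   this point is not in [P], while far away there are cells with even winding
   number: the complement is disconnected. *)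
Lemma no_cycle Z X Y s : is_thin P ->
  adjacent Z X -> adjacent Y Z -> X <> Y -> path adjacent X s -> last X s = Y ->
  {subset X :: s <= P} -> Z \in P -> Z \notin X :: s -> False.
Proof.
move=> thinP ZX YZ nXY ps ls sP ZP nZ.
set w := fun p => walk_sum (crossing p) Z (X :: rcons s Z).
have XP : X \in P by apply: sP; rewrite mem_head.
have YP : Y \in P by apply: sP; rewrite -ls mem_last.
have wr x y : w (x.+1, y) = w (x, y) (+) _ := winding_right Z X s x y.
have wu x y : w (x, y.+1) = w (x, y) (+) _ := winding_up ZX YZ ps ls x y.
have right0 W : W \notin P \/ (W.1, W.2.-1) \notin P ->
    walk_sum (crosses_right W) Z (X :: rcons s Z) = false.
  move=> nW; rewrite (loop_sumE _ ls) (crosses_right_none ps); last first.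
    by case: nW => nW; [left|right]; apply: contra nW => /sP.
  have no A B : A \in P -> B \in P -> adjacent A B -> crosses_right W A B = false.
    move=> AP BP AB; apply/negP => /(crosses_right_mem AB)[_ [] [e1 e2]];
      by move: AP BP; rewrite e1 e2 => AP BP; case: nW => /negP.
  by rewrite !no.
have up0 W : W \notin P \/ (W.1.-1, W.2) \notin P ->
    walk_sum (crosses_up W) Z (X :: rcons s Z) = false.
  move=> nW; rewrite (loop_sumE _ ls) (crosses_up_none ps); last first.
    by case: nW => nW; [left|right]; apply: contra nW => /sP.
  have no A B : A \in P -> B \in P -> adjacent A B -> crosses_up W A B = false.
    move=> AP BP AB; apply/negP => /(crosses_up_mem AB)[_ [] [e1 e2]];
      by move: AP BP; rewrite e1 e2 => AP BP; case: nW => /negP.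
  by rewrite !no.
have const W W' : W \notin P -> W' \notin P -> w W = w W'.
  apply: (winding_simple ZX YZ ps ls sP) => A nA _.
    split; apply/negP.
      by move=> /(crosses_right_mem ZX)[_ [] [e1 e2]]; case/negP: nA; rewrite -?e1 -?e2.
    by move=> /(crosses_right_mem YZ)[_ [] [e1 e2]]; case/negP: nA; rewrite -?e1 -?e2.
  split; apply/negP.
    by move=> /(crosses_up_mem ZX)[_ [] [e1 e2]]; case/negP: nA; rewrite -?e1 -?e2.
  by move=> /(crosses_up_mem YZ)[_ [] [e1 e2]]; case/negP: nA; rewrite -?e1 -?e2.
have odd_point : exists x y, w (x, y).
  have Ys : Y \in X :: s by rewrite -ls mem_last.
  have nYZ : Y <> Z by move=> e; case/negP: nZ; rewrite -e.
  have nXZ : X <> Z by move=> e; case/negP: nZ; rewrite -e mem_head.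
  have up p : p \notin X :: s \/ (p.1.-1, p.2) \notin X :: s ->
      crosses_up p Z X -> crosses_up p Y Z = false -> exists x y, w (x, y).
    case: p => x y np zx yz; have := wu x y; rewrite (loop_sumE _ ls) zx yz.
    rewrite (crosses_up_none ps np) /= addbT.
    by case xy: (w (x, y)) => wxy; [exists x, y|exists x, y.+1].
  have right p : p \notin X :: s \/ (p.1, p.2.-1) \notin X :: s ->
      crosses_right p Z X -> crosses_right p Y Z = false -> exists x y, w (x, y).
    case: p => x y np zx yz; have := wr x y; rewrite (loop_sumE _ ls) zx yz.
    rewrite (crosses_right_none ps np) /= addbT.
    by case xy: (w (x, y)) => wxy; [exists x, y|exists x.+1, y].
  case/adjacentP: (ZX) => e.
  - apply: (up X).
      by right; have -> : (X.1.-1, X.2) = Z by rewrite e; case: (Z).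
      by rewrite e /crosses_up /= !eqxx (maxn_idPr _) ?eqxx.
    by apply/negP => /(crosses_up_mem YZ)[_ [] [e1 e2]]; congruence.
  - apply: (up Z); first by left.
      by rewrite e /crosses_up /= !eqxx (maxn_idPl _) ?eqxx.
    apply/negP => /(crosses_up_mem YZ)[_ [] [e1 e2]]; first congruence.
    by apply: nXY; rewrite e2 e /= -surjective_pairing.
  - apply: (right X).
      by right; have -> : (X.1, X.2.-1) = Z by rewrite e; case: (Z).
      by rewrite e /crosses_right /= !eqxx (maxn_idPr _) ?eqxx.
    by apply/negP => /(crosses_right_mem YZ)[_ [] [e1 e2]]; congruence.
  apply: (right Z); first by left.
    by rewrite e /crosses_right /= !eqxx (maxn_idPl _) ?eqxx.
  apply/negP => /(crosses_right_mem YZ)[_ [] [e1 e2]]; first congruence.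
  by apply: nXY; rewrite e2 e /= -surjective_pairing.
have [x [y]] := odd_point.
case: x => [|x]; first by rewrite /w (winding_left ZX YZ ps ls).
case: y => [|y]; first by rewrite /w (winding_bottom ZX YZ ps ls).
move=> odd.
(* A point of odd winding number is not on the border, so four cells surround it. Following the
   sides of the missing one leads to its lower left corner without changing parity. *)
have [W nW oddW] : exists2 W, W \notin P & w W.
  have := thinP x y; rewrite !negb_and => /or4P[] nW.
  - exists (x, y) => //; move: odd.
    by rewrite wr wu !right0 ?up0 ?addbF //=; [left|right].
  - exists (x.+1, y) => //; move: odd; rewrite wu up0 ?addbF //; by left.
  - exists (x, y.+1) => //; move: odd; rewrite wr right0 ?addbF //; by left.
  by exists (x.+1, y.+1).
(* A cell above all of [P] in the leftmost column, where winding numbers vanish. *)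
pose M := (\max_(C <- P) C.2).+1.
have nM : (0, M) \notin P.
  apply/negP => MP; suff : M <= \max_(C <- P) C.2 by rewrite ltnn.
  exact: bigmax_sup_seq MP isT _.
by have := const _ _ nW nM; rewrite oddW /w (winding_left ZX YZ ps ls).
Qed.

Hypothesis connectedP : edge_connected (fun C => C \in P).

(* Otherwise a path in [P] between the two cells, closed up through one of the
   two missing cells around their common vertex, separates these missing cells. *)
Lemma no_pinch_diagonal i j : (i, j) \in P -> (i.+1, j.+1) \in P ->
  ((i.+1, j) \in P) || ((i, j.+1) \in P).
Proof.
move=> XP YP; apply/negPn/negP; rewrite negb_or => /andP[nZ' nZ].
have [s [ps sP ls]] := edge_connectedW connectedP XP YP.
have sXP : {subset (i, j) :: s <= P}.
  by move=> C; rewrite inE => /predU1P[->|/(allP sP)].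
have ZX : adjacent (i, j.+1) (i, j) by rewrite /adjacent /= !eqxx.
have YZ : adjacent (i.+1, j.+1) (i, j.+1) by rewrite /adjacent /= !eqxx orbT.
have w_eq : walk_sum (crossing (i, j.+1)) (i, j.+1) ((i, j) :: rcons s (i, j.+1)) =
            walk_sum (crossing (i.+1, j)) (i, j.+1) ((i, j) :: rcons s (i, j.+1)).
  apply: (winding_simple ZX YZ ps ls sXP) => // W nW nW'; split; apply/negP.
  - move=> /(crosses_right_mem ZX)[_ [] [e1 e2]]; last by rewrite -e1 XP in nW.
    by rewrite -e1 YP in nW'.
  - move=> /(crosses_right_mem YZ)[_ [] [e1 e2]]; first by rewrite -e1 YP in nW.
    by move: e2; rewrite -e1 /= => -[]; clear; lia.
  - move=> /(crosses_up_mem ZX)[_ [] [e1 e2]]; last by rewrite -e1 XP in nW.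
    by move: e2; rewrite -e1 /= => -[]; clear; lia.
  move=> /(crosses_up_mem YZ)[_ [] [e1 e2]]; first by rewrite -e1 YP in nW.
  by move: e2; rewrite -e1 /= => -[]; clear; lia.
(* The point (i + 1, j + 1) is reached from the corners of both missing cells. The side from (i, j +
   1) is crossed exactly once, by the step to (i, j); the side from (i + 1, j) is never crossed.
   This contradicts [w_eq]. *)
have := winding_right (i, j.+1) (i, j) s i j.+1.
rewrite (winding_up ZX YZ ps ls) w_eq !(loop_sumE _ ls).
rewrite (crosses_right_none ps); last by left; apply: contra nZ => /sXP.
rewrite (crosses_up_none ps); last by left; apply: contra nZ' => /sXP.
rewrite /crosses_right /crosses_up /= (gtn_eqF (ltnSn j)) (gtn_eqF (ltnSn i)).
rewrite (maxn_idPl (leqnSn j)) !eqxx !andbF /= addbF addbT.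
by case: (_ (+) _).
Qed.

(** Same argument with the path closed through (i, j): from its corner to that of (i + 1, j + 1),
    the only crossing is the first step of the loop. *)
Lemma no_pinch_antidiagonal i j : (i.+1, j) \in P -> (i, j.+1) \in P ->
  ((i, j) \in P) || ((i.+1, j.+1) \in P).
Proof.
move=> XP YP; apply/negPn/negP; rewrite negb_or => /andP[nZ nZ'].
have [s [ps sP ls]] := edge_connectedW connectedP XP YP.
have sXP : {subset (i.+1, j) :: s <= P}.
  by move=> C; rewrite inE => /predU1P[->|/(allP sP)].
have ZX : adjacent (i, j) (i.+1, j) by rewrite /adjacent /= !eqxx !orbT.
have YZ : adjacent (i, j.+1) (i, j) by rewrite /adjacent /= !eqxx.
have w_eq : walk_sum (crossing (i, j)) (i, j) ((i.+1, j) :: rcons s (i, j)) =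
            walk_sum (crossing (i.+1, j.+1)) (i, j) ((i.+1, j) :: rcons s (i, j)).
  apply: (winding_simple ZX YZ ps ls sXP) => // W nW nW'; split; apply/negP.
  - move=> /(crosses_right_mem ZX)[_ [] [e1 e2]]; last by rewrite -e1 XP in nW.
    by move: e2; rewrite -e1 /= => -[]; clear; lia.
  - move=> /(crosses_right_mem YZ)[_ [] [e1 e2]]; first by rewrite -e1 YP in nW.
    by move: e2; rewrite -e1 /= => -[]; clear; lia.
  - move=> /(crosses_up_mem ZX)[_ [] [e1 e2]]; last by rewrite -e1 XP in nW.
    by move: e2; rewrite -e1 /= => -[]; clear; lia.
  move=> /(crosses_up_mem YZ)[_ [] [e1 e2]]; first by rewrite -e1 YP in nW.
  by move: e2; rewrite -e1 /= => -[]; clear; lia.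
have := winding_up ZX YZ ps ls i.+1 j.
rewrite -w_eq (winding_right (i, j)) !(loop_sumE _ ls).
rewrite (crosses_right_none ps); last by left; apply: contra nZ => /sXP.
rewrite (crosses_up_none ps); last by right; apply: contra nZ => /sXP.
rewrite /crosses_right /crosses_up /= (gtn_eqF (ltnSn j)) (ltn_eqF (ltnSn i)).
rewrite (maxn_idPr (leqnSn i)) (maxn_idPl (leqnSn j)) !eqxx (gtn_eqF (ltnSn j)) /=.
rewrite !addbF addbT.
by case: (_ (+) _).
Qed.

End SimplePolyomino.

(** * Polyominoes built cell by cell *)

(** Every edge added has a fresh end point, so an unoriented edge occurs with a single label and a
    single orientation. *)
Lemma grown_edge_unique (T : eqType) (V : seq T) E R G L L' (g o g' o' : T) :
  grown V E R G -> (L, (g, o)) \in E -> (L', (g', o')) \in E ->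
  (g, o) = (g', o') \/ (g, o) = (o', g') -> L = L' /\ g = g'.
Proof.
move=> gr; elim: gr L L' g o g' o' => [a b nab|V' E' R' G' S a b c d gr IH SE cV dV ncd].
  move=> L L' g o g' o'; rewrite !inE => /eqP[-> -> ->] /eqP[-> -> ->].
  by case=> // -[e _]; rewrite e eqxx in nab.
have [_ ac bc] := grown_fresh gr SE cV; have [_ ad bd] := grown_fresh gr SE dV.
move/eqP in ncd.
move=> L L' g o g' o' /attach_edgesP[[? ? ?]|[? ? ?]|[? ? ?]|eE]
  /attach_edgesP[[? ? ?]|[? ? ?]|[? ? ?]|eE'] [] [? ?]; try (split; congruence); try congruence;
  try (by case: (grown_fresh gr eE cV) (grown_fresh gr eE dV) => ? ? ? [? ? ?]; congruence);
  try (by case: (grown_fresh gr eE' cV) (grown_fresh gr eE' dV) => ? ? ? [? ? ?]; congruence).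
  by apply: IH eE eE' _; left; congruence.
by apply: IH eE eE' _; right; congruence.
Qed.

(* Reflection in the diagonal when [b] holds: it lets rows and columns be
   treated alike. *)
Definition frame (b : bool) (p : point) : point := if b then (p.2, p.1) else p.

(* In the frame [b], the edge from [(x, y)] to [(x, y + 1)], oriented by [o]. *)
Definition oriented_edge (b : bool) (x y : nat) (o : bool) : point * point :=
  (frame b (x, y + o), frame b (x, y + ~~ o)).

Lemma frameK b : involutive (frame b).
Proof. by case: b => -[]. Qed.

Lemma frame_negb b x y : frame (~~ b) (x, y) = frame b (y, x).
Proof. by case: b. Qed.

Lemma frame_inj b : injective (frame b).
Proof. exact: inv_inj (frameK b). Qed.

Lemma adjacent_frame b C D : adjacent (frame b C) (frame b D) = adjacent C D.
Proof. by case: b; rewrite // /adjacent /= orbC. Qed.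

Lemma mem_frame b C p : (frame b p \in cell_vertices (frame b C)) = (p \in cell_vertices C).
Proof. by case: b; rewrite // !mem_cell_vertices /= andbC. Qed.

Lemma oriented_edge_inj b x y o b' x' y' o' :
  oriented_edge b x y o = oriented_edge b' x' y' o' ->
  [/\ b = b', x = x', y = y' & o = o'].
Proof.
by rewrite /oriented_edge; case: b b' o o' => -[] [] [] /=; rewrite ?addn0 ?addn1 => -[*];
  (exfalso; lia) || (split; lia).
Qed.

Lemma oriented_edge_swap b x y o o' :
  oriented_edge b x y o = oriented_edge b x y o' \/
  oriented_edge b x y o = ((oriented_edge b x y o').2, (oriented_edge b x y o').1).
Proof. by case: o o' => -[]; rewrite /oriented_edge ?negbK; auto. Qed.

(* [Cs] lists the cells, latest first; the other arguments are those of [grown].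
   The side [r] tells whether the cell [(z, y)] of the frame [b] is glued along its edge of
   abscissa [z] or [z + 1]. *)
Inductive built (b0 : bool) (x0 y0 : nat) (o0 : bool) :
  seq cell -> seq point -> seq (point * (point * point)) ->
  seq ((point * point) * (point * point)) -> seq (point * point) -> Prop :=
| built_edge (e := oriented_edge b0 x0 y0 o0) :
    built b0 x0 y0 o0 [::] [:: e.2; e.1] [:: (e.1, e)] [::] [::]
| built_cell Cs V E R G S b z y (r : bool) o
    (e := oriented_edge b (z + r) y o) (f := oriented_edge b (z + ~~ r) y o) :
    built b0 x0 y0 o0 Cs V E R G -> (S, e) \in E ->
    frame b (z, y) \notin Cs ->
    (forall X, X \in Cs -> adjacent (frame b (z, y)) X ->
       X = frame b (if r then z.+1 else z.-1, y)) ->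
    f.1 \notin V -> f.2 \notin V ->
    built b0 x0 y0 o0 (frame b (z, y) :: Cs) [:: f.2, f.1 & V]
      (attach_edges S e.1 e.2 f.1 f.2 E) (attach_rules S f.1 f.2 E R) ((S, f.1) :: G).

Section Built.

Variables (b0 : bool) (x0 y0 : nat) (o0 : bool).

Local Notation built := (built b0 x0 y0 o0).

Lemma oriented_edge_neq b x y o :
  (oriented_edge b x y o).1 != (oriented_edge b x y o).2.
Proof. by rewrite (inj_eq (@frame_inj b)) xpair_eqE; case: o => /=; lia. Qed.

Lemma built_grown Cs V E R G : built Cs V E R G -> grown V E R G.
Proof.
elim=> [e|{}Cs {}V {}E {}R {}G S b z y r o e f _ gr SE _ _ f1 f2].
  exact: grown_edge (oriented_edge_neq _ _ _ _).
exact: grown_cell gr SE f1 f2 (oriented_edge_neq _ _ _ _).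
Qed.

Lemma built_label_unique Cs V E R G L L' b x y o o' : built Cs V E R G ->
  (L, oriented_edge b x y o) \in E -> (L', oriented_edge b x y o') \in E ->
  L = L' /\ o = o'.
Proof.
move=> /built_grown gr eE eE'.
have [//|-> e1] := grown_edge_unique gr eE eE'; first exact: oriented_edge_swap.
by split=> //; move: e1 => /frame_inj[]; case: o o' {eE eE'} => -[] //=; lia.
Qed.

(** In the transposed frame the new strip consists of two edges at abscissae [y] and [y + 1]. Their
    good ends are the new points, on the line [z + ~~ r], hence the orientation [~~ r] whatever [o]
    is. *)
Lemma attach_built_edgesP S b z y (r : bool) o E L e
    (a := oriented_edge b (z + r) y o) (c := oriented_edge b (z + ~~ r) y o) :
  (L, e) \in attach_edges S a.1 a.2 c.1 c.2 E ->
  [\/ L = S /\ e = c,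
      exists i : bool, L = c.1 /\ e = oriented_edge (~~ b) (y + i) z (~~ r)
    | (L, e) \in E].
Proof.
case: e => g h /attach_edgesP[[-> -> ->]|[-> -> ->]|[-> -> ->]|eE].
- by constructor 1.
- by constructor 2; exists o; rewrite /oriented_edge !frame_negb negbK.
- by constructor 2; exists (~~ o); rewrite /oriented_edge !frame_negb negbK.
by constructor 3.
Qed.

Lemma mem_attach_built_edges S b z y (r : bool) o E
    (a := oriented_edge b (z + r) y o) (c := oriented_edge b (z + ~~ r) y o) :
  [/\ (S, c) \in attach_edges S a.1 a.2 c.1 c.2 E,
      forall i : bool, (c.1, oriented_edge (~~ b) (y + i) z (~~ r))
        \in attach_edges S a.1 a.2 c.1 c.2 E
    & {subset E <= attach_edges S a.1 a.2 c.1 c.2 E}].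
Proof.
have [m1 m2 m3 m4] := mem_attach_edges S a.1 a.2 c.1 c.2 E.
split=> // i.
move: m2 m3; rewrite /oriented_edge !frame_negb negbK.
by case: i; rewrite /a /c /oriented_edge /=; case: (o).
Qed.

Lemma built_aligned Cs V E R G L b x y o b' x' y' o' : built Cs V E R G ->
  (L, oriented_edge b x y o) \in E -> (L, oriented_edge b' x' y' o') \in E ->
  [/\ b' = b, y' = y, o' = o &
      forall z, minn x x' <= z < maxn x x' -> frame b (z, y) \in Cs].
Proof.
move=> bt; elim: bt L b x y o b' x' y' o' =>
  [e|{}Cs {}V {}E {}R {}G S b z y r o e f bt IH SE nC nb f1 f2] L b1 x1 y1 o1 b2 x2 y2 o2.
  rewrite !inE => /eqP/(congr1 snd)/oriented_edge_inj[-> -> -> ->].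
  move=> /eqP/(congr1 snd)/oriented_edge_inj[-> -> -> ->]; split=> // z; lia.
have gr := built_grown bt.
have [Sf1 _ _] : [/\ S <> f.1, e.1 <> f.1 & e.2 <> f.1].
  exact: (grown_fresh gr SE f1).
have fresh L' g : (L', g) \in E -> L' <> f.1.
  by case: g => g h gE; have [] := grown_fresh gr gE f1.
have sub b' x' x'' y' : (forall z', minn x' x'' <= z' < maxn x' x'' -> frame b' (z', y') \in Cs) ->
    forall z', minn x' x'' <= z' < maxn x' x'' -> frame b' (z', y') \in frame b (z, y) :: Cs.
  by move=> h z' /h; rewrite inE => ->; rewrite orbT.
have new_old L' b' x' y' o' : L' = S -> (L', oriented_edge b' x' y' o') \in E ->
    [/\ b' = b, y' = y, o' = o & forall z', minn (z + ~~ r) x' <= z' < maxn (z + ~~ r) x' ->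
        frame b (z', y) \in frame b (z, y) :: Cs].
  move=> -> e'E; have [-> -> -> btw] := IH _ _ _ _ _ _ _ _ _ SE e'E; split=> // z' z'P.
  rewrite inE; have [->|nz] := eqVneq z' z; first by rewrite eqxx.
  apply/orP; right; apply: (btw).
  (* The cells between two old edges of a strip are old, so [x'] lies on the side of [e] away from
     the new cell. *)
  have : ~~ (minn (z + r) x' <= z < maxn (z + r) x').
    by apply: contra nC => /btw.
  by move: z'P nz; clear; case: r => /=; lia.
case/attach_built_edgesP=> [[LS e1]|[i [Lf e1]]|eE].
- case/attach_built_edgesP=> [[_ e2]|[i [Lf _]]|eE']; last first.
  + have [-> -> -> ->] := oriented_edge_inj e1.
    exact: new_old LS eE'.
  + by case: Sf1; rewrite -LS.
  have [-> -> -> ->] := oriented_edge_inj e1; have [-> -> -> ->] := oriented_edge_inj e2.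
  by split=> // z'; clear; lia.
- case/attach_built_edgesP=> [[LS _]|[j [_ e2]]|eE']; first by case: Sf1; rewrite -LS.
    have [-> -> -> ->] := oriented_edge_inj e1; have [-> -> -> ->] := oriented_edge_inj e2.
    split=> // z' z'P; rewrite inE frame_negb.
    have -> : z' = y by move: z'P; clear; case: i; case: j => /=; lia.
    by rewrite eqxx.
  by case: (fresh _ _ eE').
case/attach_built_edgesP=> [[LS e2]|[i [Lf _]]|eE'].
- have [-> -> -> ->] := oriented_edge_inj e2.
  have [-> -> -> btw] := new_old _ _ _ _ _ LS eE; split=> // z' z'P.
  by apply: btw; rewrite minnC maxnC.
- by case: (fresh _ _ eE).
by have [-> -> -> btw] := IH _ _ _ _ _ _ _ _ _ eE eE'; split=> //; apply: sub.
Qed.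

(** The new cell has only one neighbour among the old ones. A run through it across its gluing
    direction is therefore that cell alone, with the new strip. A run along that direction has it at
    an end; the rest is old and shares the edge [e], whose label can only be [S]. *)
Lemma built_interval Cs V E R G b x x' y : built Cs V E R G -> x < x' ->
  (forall z, x <= z < x' -> frame b (z, y) \in Cs) ->
  exists L o, (L, oriented_edge b x y o) \in E /\ (L, oriented_edge b x' y o) \in E.
Proof.
move=> bt; elim: bt b x x' y =>
  [e|{}Cs {}V {}E {}R {}G S b z y r o e f bt IH SE nC nb f1 f2] b1 x x' y1 xx' inC.
  by have := inC x; rewrite leqnn xx' => /(_ isT).
have [m1 m2 m3] := mem_attach_built_edges S b z y r o E; rewrite -/e -/f in m1 m2 m3.
have [[w wx Cw]|old] : (exists2 w, x <= w < x' & frame b1 (w, y1) = frame b (z, y)) \/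
    (forall w, x <= w < x' -> frame b1 (w, y1) \in Cs).
  have [|no] := pselect (exists2 w, x <= w < x' & frame b1 (w, y1) = frame b (z, y));
    [by left|right].
  move=> w wx; have := inC w wx; rewrite inE => /predU1P[e1|//].
  by case: no; exists w.
- have inCs w' y' b' : frame b' (w', y') \in frame b (z, y) :: Cs ->
      frame b' (w', y') <> frame b (z, y) -> adjacent (frame b (z, y)) (frame b' (w', y')) ->
      frame b' (w', y') = frame b (if r then z.+1 else z.-1, y).
    by rewrite inE => /predU1P[//|X _]; apply: nb.
  have [eb|nb1] := eqVneq b1 b; last first.
    have {nb1} eb : b1 = ~~ b by move: nb1; case: (b1); case: (b).
    rewrite eb in inC Cw *; move: Cw; rewrite frame_negb => /frame_inj[y1z wy].
    rewrite y1z wy in inC wx *.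
    have across v : x <= v < x' -> v = y.+1 \/ y = v.+1 -> False.
      move=> vx vy; have := inCs _ _ _ (inC _ vx); rewrite frame_negb.
      rewrite adjacent_frame /adjacent /= eqxx => H.
      have /frame_inj[] : frame b (z, v) = frame b (if r then z.+1 else z.-1, y).
        by apply: H; [move=> /frame_inj[]|]; move: vy; clear; lia.
      by move: vy; clear; lia.
    have [-> ->] : x = y /\ x' = y.+1.
      have a1 := across y.+1; have a2 := across y.-1; move: a1 a2 wx.
      by clear; lia.
    exists f.1, (~~ r); have := m2 false; have := m2 true; rewrite addn0 addn1.
    by split.
  rewrite eb in inC Cw *; move: Cw => /frame_inj[wz y1y]; rewrite wz y1y in inC wx *.
  have across v : x <= v < x' -> v = z.+1 \/ z = v.+1 -> v = if r then z.+1 else z.-1.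
    move=> vx vz; have := inCs _ _ _ (inC _ vx).
    rewrite adjacent_frame /adjacent /= eqxx => H.
    have /frame_inj[] // : frame b (v, y) = frame b (if r then z.+1 else z.-1, y).
    by apply: H; [move=> /frame_inj[]|]; move: vz; clear; lia.
  have old lo hi : x <= lo -> hi <= x' -> hi <= z \/ z < lo ->
      forall v, lo <= v < hi -> frame b (v, y) \in Cs.
    move=> xlo hix zP v vP; have := inC v; rewrite inE => /(_ _)/predU1P[].
    + by move: vP xlo hix; clear; lia.
    + by move=> /frame_inj[ev]; move: vP zP; rewrite ev; clear; lia.
    by [].
  have mS (i : bool) : (S, oriented_edge b (z + i) y o) \in
      attach_edges S e.1 e.2 f.1 f.2 E.
    have [->|ir] := eqVneq i r; first exact: m3 SE.
    by have -> : i = ~~ r by case: (i) (r) ir => -[].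
  have mz := mS false; have mz1 := mS true; rewrite /= addn0 in mz; rewrite /= addn1 in mz1.
  have SE' : (S, oriented_edge b (z + r) y o) \in E by [].
  case: (r) SE' across => /=; rewrite ?addn0 ?addn1 => SE' across.
  - have -> : x = z.
      by have := across z.-1; move: wx; clear; lia.
    have [->|nx'] := eqVneq x' z.+1; first by exists S, o.
    have [||L [o1 [eE eE']]] := IH b z.+1 x' y.
    + by move: nx' wx; clear; lia.
    + by apply: old; rewrite ?leqnn //; [move: wx; clear; lia|right].
    have [LS oo] := built_label_unique bt eE SE'; rewrite {}LS {}oo in eE eE'.
    by exists S, o; split=> //; apply: m3.
  have x'z : x' = z.+1.
    by have := across z.+1; move: wx; clear; lia.
  rewrite x'z; have [->|nx] := eqVneq x z; first by exists S, o.
  have [||L [o1 [eE eE']]] := IH b x z y.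
  + by move: nx wx; clear; lia.
  + by apply: old; rewrite ?x'z //; left.
  have [LS oo] := built_label_unique bt eE' SE'; rewrite {}LS {}oo in eE eE'.
  by exists S, o; split=> //; apply: m3.
have [L [o1 [eE eE']]] := IH _ _ _ _ xx' old.
by exists L, o1; split; apply: m3.
Qed.

Lemma built_cells Cs V E R G C S N : built Cs V E R G -> (C, (S, N)) \in zip Cs G ->
  exists b z y o o', [/\ C = frame b (z, y), (S, oriented_edge b z y o) \in E
                       & (N, oriented_edge (~~ b) y z o') \in E].
Proof.
move=> bt; elim: bt C S N => // {}Cs {}V {}E {}R {}G S b z y r o e f bt IH SE nC nb f1 f2.
have [m1 m2 m3] := mem_attach_built_edges S b z y r o E; rewrite -/e -/f in m1 m2 m3.
move=> C L N; rewrite inE => /predU1P[[-> -> ->]|CG].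
  exists b, z, y, o, (~~ r); split=> //; last by have := m2 false; rewrite addn0.
  move: m1 (m3 _ SE); rewrite /e /f; case: (r) => /=; rewrite ?addn0 //.
have [b' [z' [y' [o1 [o2 [-> eE eE']]]]]] := IH _ _ _ CG.
by exists b', z', y', o1, o2; split=> //; apply: m3.
Qed.

End Built.

(** * Rook configurations and matchings *)

Section Configurations.

Variables (X : choiceType) (T : eqType).

Local Notation site := (X * (T * T))%type.

Definition share (e e' : T * T) : bool :=
  [|| e.1 == e'.1, e.1 == e'.2, e.2 == e'.1 | e.2 == e'.2].

(** Lists the matchings counted by [matching_count] as sets of cells, each site being a cell with
    its two strips. *)
Fixpoint configurations (s : seq site) (A : pred T) (k : nat) : seq {fset X} :=
  if s is x :: s' then
    configurations s' A k
    ++ (if A x.2.1 || A x.2.2 then [::]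
        else if k is k'.+1 then
          [seq (x.1 |` B)%fset
             | B <- configurations s' (fun l => A l || pred2 x.2.1 x.2.2 l) k']
        else [::])
  else if k == 0 then [:: fset0] else [::].

Lemma size_configurations s A k :
  size (configurations s A k) = matching_count (unzip2 s) A k.
Proof.
elim: s A k => [|x s IH] A k /=; first by case: eqP.
rewrite size_cat IH; case: ifP => // _; case: k => // k.
by rewrite size_map IH.
Qed.

Definition independent (s : seq site) (B : {fset X}) : Prop :=
  forall x y, x \in s -> y \in s -> x.1 \in B -> y.1 \in B -> x.1 != y.1 ->
    ~~ share x.2 y.2.

Lemma shareC e e' : share e e' = share e' e.
Proof.
rewrite /share ![e'.1 == _]eq_sym ![e'.2 == _]eq_sym.
by do 4 case: (_ == _).
Qed.

Lemma configurationsP s (A : pred T) k (B : {fset X}) : uniq (unzip1 s) ->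
  reflect [/\ {subset B <= unzip1 s}, #|` B| = k,
              forall x, x \in s -> x.1 \in B -> ~~ (A x.2.1 || A x.2.2)
            & independent s B]
          (B \in configurations s A k).
Proof.
elim: s A k B => [|x s IH] A k B /=.
  move=> _; apply: (iffP idP).
    by case: eqP => // ->; rewrite inE => /eqP->; split=> // y; rewrite inE.
  case=> sB <- _ _; suff -> : B = fset0 by rewrite cardfs0 inE.
  by apply/fsetP => y; rewrite inE; apply/negP => /sB.
move=> /andP[xs us]; rewrite mem_cat.
have x_notin y : y \in s -> y.1 != x.1.
  by move=> ys; apply: contraNneq xs => <-; apply: map_f.
apply: (iffP orP) => [[/IH[//|sB cB AB iB]|]|[sB cB AB iB]].
- have xB : x.1 \notin B by apply: contra xs => /sB.
  split=> // [y /sB|y|y z].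
  + by rewrite inE => ->; rewrite orbT.
  + by rewrite inE => /predU1P[-> xB'|]; [rewrite xB' in xB|apply: AB].
  rewrite !inE => /predU1P[->|ys] /predU1P[->|zs] yB zB nyz.
  + by rewrite eqxx in nyz.
  + by rewrite yB in xB.
  + by rewrite zB in xB.
  exact: iB.
- case: ifPn => // nAx; case: k => // k /mapP[B' /(IH _ _ _ us)[sB cB AB iB] ->].
  have xB : x.1 \notin B' by apply: contra xs => /sB.
  split=> [y||y|y z].
  + by rewrite !inE => /predU1P[->|/sB ->]; rewrite ?eqxx ?orbT.
  + by rewrite cardfsU1 xB cB.
  + rewrite !inE => /predU1P[-> //|ys].
    rewrite (negPf (x_notin _ ys)) /= => /(AB _ ys).
    by apply: contra => /orP[] ->; rewrite ?orbT.
  have new y' : y' \in s -> y'.1 \in B' -> ~~ share x.2 y'.2.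
    move=> ys /(AB _ ys); apply: contra; rewrite /share /= ![x.2.1 == _]eq_sym ![x.2.2 == _]eq_sym.
    by case/or4P=> ->; rewrite ?orbT.
  rewrite !inE => /predU1P[->|ys] /predU1P[->|zs].
  + by rewrite eqxx.
  + by rewrite eqxx (negPf (x_notin _ zs)) /= => _ zB _; apply: new.
  + by rewrite eqxx (negPf (x_notin _ ys)) /= => yB _ _; rewrite shareC; apply: new.
  by rewrite (negPf (x_notin _ ys)) (negPf (x_notin _ zs)) /=; apply: iB.
have [xB|xB] := boolP (x.1 \in B); last first.
  left; apply/IH => //; split=> // [y yB|y ys|y z ys zs].
  - by have := sB _ yB; rewrite inE => /predU1P[yx|//]; rewrite -yx yB in xB.
  - by apply: AB; rewrite inE ys orbT.
  by apply: iB; rewrite inE ?ys ?zs orbT.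
right; rewrite (negPf (AB _ (mem_head _ _) xB)).
have := cardfsD1 x.1 B; rewrite xB cB => ->.
apply/mapP; exists (B `\ x.1)%fset; last by rewrite fsetD1K.
apply/IH => //; split=> // [y|y ys|y z ys zs].
- rewrite in_fsetD1 => /andP[nyx /sB]; rewrite inE => /predU1P[yx|//].
  by rewrite yx eqxx in nyx.
- rewrite in_fsetD1 => /andP[nyx yB].
  have ys' : y \in x :: s by rewrite inE ys orbT.
  have := AB _ ys' yB; have := iB _ _ (mem_head _ _) ys' xB yB.
  rewrite eq_sym nyx /share => /(_ isT); rewrite !negb_or /=.
  rewrite ![x.2.1 == _]eq_sym ![x.2.2 == _]eq_sym.
  by case/and4P=> -> -> -> -> /andP[-> ->].
rewrite !in_fsetD1 => /andP[_ yB] /andP[_ zB].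
by apply: iB; rewrite ?inE ?ys ?zs ?orbT.
Qed.

Lemma configurations_uniq s A k : uniq (unzip1 s) -> uniq (configurations s A k).
Proof.
elim: s A k => [|x s IH] A k /=; first by case: eqP.
move=> /andP[xs us]; rewrite cat_uniq IH //=; case: ifP => // _; case: k => // k.
have notin A' j B : B \in configurations s A' j -> x.1 \notin B.
  by case/configurationsP=> // sB _ _ _; apply: contra xs => /sB.
apply/andP; split.
  apply/hasPn => _ /mapP[B _ ->]; apply/negP => /notin.
  by rewrite !inE eqxx.
rewrite map_inj_in_uniq ?IH // => B B' /notin xB /notin xB' e.
by rewrite -(fsetU1K xB) e fsetU1K.
Qed.

End Configurations.

Section Built.

Variables (b0 : bool) (x0 y0 : nat) (o0 : bool).

Local Notation built := (built b0 x0 y0 o0).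

Lemma frame_vertexP b z y p : p \in cell_vertices (frame b (z, y)) ->
  exists i j : bool, p = frame b (z + i, y + j).
Proof.
rewrite -[p](frameK b) mem_frame; case: (frame b p) => x t.
rewrite mem_cell_vertices /= => /andP[xP tP].
exists (x != z), (t != y); congr (frame b (_, _)).
  by move: xP; clear; case: eqP => /=; lia.
by move: tP; clear; case: eqP => /=; lia.
Qed.

Lemma frame_vertex b z y (i j : bool) :
  frame b (z + i, y + j) \in cell_vertices (frame b (z, y)).
Proof. by rewrite mem_frame mem_cell_vertices /=; case: i; case: j; lia. Qed.

Lemma built_cell_vertices Cs V E R G C p : built Cs V E R G ->
  C \in Cs -> p \in cell_vertices C -> p \in V.
Proof.
move=> bt; elim: bt C p => // {}Cs {}V {}E {}R {}G S b z y r o e f bt IH SE nC nb f1 f2 C p.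
rewrite inE => /predU1P[->|CC] pC; last by rewrite !inE (IH _ _ CC pC) !orbT.
have [_ eV1 eV2] := grown_mem (built_grown bt) SE.
have [i [j ->]] := frame_vertexP pC.
have [->|ir] := eqVneq i r.
  have [->|jo] := eqVneq j o; first by rewrite !inE eV1 !orbT.
  have -> : j = ~~ o by case: (j) (o) jo => -[].
  by rewrite !inE eV2 !orbT.
have -> : i = ~~ r by case: (i) (r) ir => -[].
have [->|jo] := eqVneq j o; first by rewrite !inE eqxx !orbT.
have -> : j = ~~ o by case: (j) (o) jo => -[].
by rewrite !inE eqxx.
Qed.

Lemma built_point_cell Cs V E R G p : built Cs V E R G -> p \in V ->
  (exists2 C, C \in Cs & p \in cell_vertices C) \/
  p \in [:: (oriented_edge b0 x0 y0 o0).1; (oriented_edge b0 x0 y0 o0).2].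
Proof.
move=> bt; elim: bt p => [e|{}Cs {}V {}E {}R {}G S b z y r o e f bt IH SE nC nb f1 f2] p.
  by rewrite !inE orbC; right.
have old C : C \in Cs -> C \in frame b (z, y) :: Cs by rewrite inE orbC => ->.
rewrite !inE => /orP[/eqP->|/orP[/eqP->|/IH[[C CC pC]|]]].
- by left; exists (frame b (z, y)); rewrite ?mem_head //; apply: frame_vertex.
- by left; exists (frame b (z, y)); rewrite ?mem_head //; apply: frame_vertex.
- by left; exists C => //; apply: old.
by rewrite !inE; right.
Qed.

Lemma built_uniq Cs V E R G : built Cs V E R G -> uniq Cs /\ size Cs = size G.
Proof.
elim=> // {}Cs {}V {}E {}R {}G S b z y r o e f _ [uC sC] _ nC _ _ _ /=.
by rewrite nC uC sC.
Qed.

Lemma rooks_attack_frame (P : {fset cell}) b z z' y : z != z' ->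
  (forall w, minn z z' <= w < maxn z z' -> frame b (w, y) \in P) ->
  rooks_attack P (frame b (z, y)) (frame b (z', y)).
Proof.
move=> nzz' btw; apply/andP; split.
  by rewrite (inj_eq (@frame_inj b)) xpair_eqE negb_and nzz'.
apply/orP; case: b btw => /= btw; [right|left]; rewrite eqxx /=;
  apply/allP => w; rewrite mem_index_iota => wP; apply: btw; move: wP; clear; lia.
Qed.

Lemma rooks_attackP (P : {fset cell}) C D : C \in P -> D \in P -> rooks_attack P C D ->
  exists b z z' y, [/\ C = frame b (z, y), D = frame b (z', y), z != z' &
    forall w, minn z z' <= w <= maxn z z' -> frame b (w, y) \in P].
Proof.
case: C D => [i j] [k l] + + /andP[+ /orP[]] /= /andP[/eqP e /allP btw]; move: btw; rewrite {}e.
  move=> btw CP DP nCD; exists false, i, k, l; split=> //.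
    by apply: contra nCD => /eqP ->.
  move=> w wP; have [->//|nwi] := eqVneq w i; have [->//|nwk] := eqVneq w k.
  by apply: btw; rewrite mem_index_iota; move: wP nwi nwk; clear; lia.
move=> btw CP DP nCD; exists true, j, l, k; split=> //.
  by apply: contra nCD => /eqP ->.
move=> w wP; have [->//|nwi] := eqVneq w j; have [->//|nwk] := eqVneq w l.
by apply: btw; rewrite mem_index_iota /=; move: wP nwi nwk; clear; lia.
Qed.

Lemma built_label_cell Cs V E R G C S N b z y L o : built Cs V E R G ->
  (C, (S, N)) \in zip Cs G -> C = frame b (z, y) -> (L, oriented_edge b z y o) \in E ->
  L = S \/ L = N.
Proof.
move=> bt /(built_cells bt)[b1 [z1 [y1 [o1 [o2 [-> SE NE]]]]]] e LE.
have [eb|eb] := eqVneq b1 b.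
  rewrite eb in e SE; move: e SE => /frame_inj[-> ->] SE.
  by left; have [->] := built_label_unique bt LE SE.
have {}eb : b = ~~ b1 by case: (b1) (b) eb => -[].
rewrite eb frame_negb in e LE; move: e NE => /frame_inj[-> ->] NE.
by right; have [->] := built_label_unique bt LE NE.
Qed.

(** A run of cells of [P] from C to D gives them a common strip by [built_interval], and a cell has
    no strips besides its two labels. Conversely [built_aligned] fills the gap between two edges of
    a strip with cells of [P]. *)
Lemma built_attack Cs V E R G (P : {fset cell}) C D e f : built Cs V E R G -> Cs =i P ->
  (C, e) \in zip Cs G -> (D, f) \in zip Cs G -> C != D ->
  rooks_attack P C D = share e f.
Proof.
case: e f => [S N] [S' N'] bt CsP CG DG nCD.
have mem_zip X g : (X, g) \in zip Cs G -> X \in P.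
  move=> XG; rewrite -CsP; have [_ sCG] := built_uniq bt.
  by rewrite -(unzip1_zip (eq_leq sCG)); apply/mapP; exists (X, g).
have lab X S1 N1 L : (X, (S1, N1)) \in zip Cs G -> L = S1 \/ L = N1 ->
    exists b z y o, X = frame b (z, y) /\ (L, oriented_edge b z y o) \in E.
  move=> /(built_cells bt)[b [z [y [o [o' [-> SE NE]]]]]] [->|->].
    by exists b, z, y, o.
  by exists (~~ b), y, z, o'; rewrite frame_negb.
apply/idP/idP => [|/or4P sh].
  case/(rooks_attackP (mem_zip _ _ CG) (mem_zip _ _ DG)) => b [z [z' [y [Ce De nz btw]]]].
  have [L [o [o' [Lz Lz']]]] : exists L o o', (L, oriented_edge b z y o) \in E /\
      (L, oriented_edge b z' y o') \in E.
    wlog ltz : z z' C D S N S' N' {CG DG nCD Ce De} nz btw / z < z' => [hwlog|].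
      case: (ltngtP z z') nz => // ltz nz; first by apply: hwlog btw _; rewrite // neq_ltn ltz.
      have [L [o [o' [L1 L2]]]] : exists L o o', (L, oriented_edge b z' y o) \in E /\
          (L, oriented_edge b z y o') \in E.
        by apply: hwlog => //; [rewrite neq_ltn ltz|rewrite minnC maxnC].
      by exists L, o', o.
    have [||L [o [L1 L2]]] := built_interval (b := b) (x := z) (x' := z'.+1) (y := y) bt.
    - exact: ltnW.
    - by move=> w wP; rewrite CsP; apply: btw; move: wP ltz; clear; lia.
    have [||L' [o' [L1' L2']]] := built_interval (b := b) (x := z') (x' := z'.+1) (y := y) bt.
    - exact: ltnSn.
    - by move=> w wP; rewrite CsP; apply: btw; move: wP ltz; clear; lia.
    have [LL _] := built_label_unique bt L2 L2'.
    by exists L, o, o'; rewrite LL in L1 *.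
  have := built_label_cell bt CG Ce Lz; have := built_label_cell bt DG De Lz'.
  by rewrite /share /= => -[] -> [] ->; rewrite eqxx ?orbT.
have [L LS LS'] : exists2 L, L = S \/ L = N & L = S' \/ L = N'.
  by case: sh => /eqP /= ->; [exists S'|exists N'|exists S'|exists N']; auto.
have [b [z [y [o [Ce LE]]]]] := lab _ _ _ _ CG LS.
have [b' [z' [y' [o' [De LE']]]]] := lab _ _ _ _ DG LS'.
have [eb ey _ btw] := built_aligned bt LE LE'.
rewrite {}eb {}ey in De; rewrite Ce De; apply: rooks_attack_frame.
  by apply: contra nCD => /eqP e; rewrite Ce De e.
by move=> w /btw; rewrite CsP.
Qed.

Lemma built_rook_count Cs V E R G (P : {fset cell}) k : built Cs V E R G -> Cs =i P ->
  rook_count P k = matching_count G xpred0 k.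
Proof.
move=> bt CsP; have [uCs sCs] := built_uniq bt.
have u2 : unzip2 (zip Cs G) = G by rewrite unzip2_zip ?sCs.
have u1 : unzip1 (zip Cs G) = Cs by rewrite unzip1_zip ?sCs.
have uz : uniq (unzip1 (zip Cs G)) by rewrite u1.
rewrite /rook_count -[in RHS]u2 -size_configurations.
apply/perm_size/uniq_perm; first exact: fset_uniq.
  exact: configurations_uniq.
move=> B; rewrite [LHS]in_fset /= inE fpowersetE.
apply/and3P/configurationsP => // [[/fsubsetP sB /eqP cB /forallP iB]|[sB cB _ iB]].
  split=> // [C /sB|[C e] [D f] /= CG DG CB DB nCD].
    by rewrite u1 CsP.
  rewrite -(built_attack bt CsP CG DG nCD).
  by have /forallP/(_ [` DB]%fset) := iB [` CB]%fset.
split; first by apply/fsubsetP => C /sB; rewrite u1 CsP.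
  by rewrite cB.
apply/forallP => C; apply/forallP => D.
have lab (X : B) : exists e, (val X, e) \in zip Cs G.
  have /mapP[[X' e] XG /= ->] : val X \in unzip1 (zip Cs G) by apply: sB; apply: valP.
  by exists e.
have [e CG] := lab C; have [f DG] := lab D.
have [eCD|nCD] := eqVneq (val C) (val D); first by rewrite /rooks_attack eCD eqxx.
by rewrite (built_attack bt CsP CG DG nCD); apply: iB CG DG _ _ nCD; apply: valP.
Qed.

End Built.

(** * Simple thin polyominoes can be built *)

Section Existence.

Variable P : {fset cell}.
Hypotheses (simpleP : is_simple P) (thinP : is_thin P).
Hypothesis connectedP : edge_connected (fun C => C \in P).

(** Distinct cells with a common vertex share a side or are diagonal neighbours; in the second case
    the absence of pinches supplies [W]. *)
Lemma corner_cells C X p : C \in P -> X \in P -> C != X ->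
  p \in cell_vertices C -> p \in cell_vertices X ->
  adjacent C X \/
  exists W, [/\ W \in P, adjacent C W, adjacent W X & p \in cell_vertices W].
Proof.
have diag i j : (i, j) \in P -> (i.+1, j.+1) \in P ->
    exists W, [/\ W \in P, adjacent (i, j) W, adjacent W (i.+1, j.+1)
                & (i.+1, j.+1) \in cell_vertices W].
  move=> CP XP; have /orP[WP|WP] := no_pinch_diagonal simpleP connectedP CP XP.
    by exists (i.+1, j); rewrite WP mem_cell_vertices /adjacent /= !eqxx !leqnn !leqnSn !orbT.
  by exists (i, j.+1); rewrite WP mem_cell_vertices /adjacent /= !eqxx !leqnn !leqnSn !orbT.
have anti i j : (i.+1, j) \in P -> (i, j.+1) \in P ->
    exists W, [/\ W \in P, adjacent (i.+1, j) W, adjacent W (i, j.+1)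
                & (i.+1, j.+1) \in cell_vertices W].
  move=> CP XP; have /orP[WP|WP] := no_pinch_antidiagonal simpleP connectedP CP XP.
    by exists (i, j); rewrite WP mem_cell_vertices /adjacent /= !eqxx !leqnn !leqnSn !orbT.
  by exists (i.+1, j.+1); rewrite WP mem_cell_vertices /adjacent /= !eqxx !leqnn !leqnSn !orbT.
have sym C' X' p' :
    (exists W, [/\ W \in P, adjacent C' W, adjacent W X' & p' \in cell_vertices W]) ->
    exists W, [/\ W \in P, adjacent X' W, adjacent W C' & p' \in cell_vertices W].
  by case=> W [WP CW WX pW]; exists W; split=> //; rewrite adjacent_sym.
case: C X p => [i j] [k l] [x y] CP XP nCX; rewrite !mem_cell_vertices /= => pC pX.
have near a b c : b <= a <= b.+1 -> c <= a <= c.+1 ->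
    [\/ b = c, c = b.+1 /\ a = b.+1 | b = c.+1 /\ a = c.+1].
  by case: (ltngtP b c) => bc h1 h2; [constructor 2|constructor 3|constructor 1];
    move: bc h1 h2; clear; lia.
have [pC1 pC2] := andP pC; have [pX1 pX2] := andP pX.
case: (near _ _ _ pC1 pX1) (near _ _ _ pC2 pX2) => [e|[e x']|[e x']] [e'|[e' y']|[e' y']]; subst.
- by rewrite eqxx in nCX.
- by left; rewrite /adjacent /= !eqxx orbT.
- by left; rewrite /adjacent /= !eqxx.
- by left; rewrite /adjacent /= !eqxx !orbT.
- by right; apply: diag.
- by right; apply: sym; apply: anti.
- by left; rewrite /adjacent /= !eqxx !orbT.
- by right; apply: anti.
by right; apply: sym; apply: diag.
Qed.

Definition connected_in (Cs : seq cell) : Prop :=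
  forall C D, C \in Cs -> D \in Cs ->
    exists s, [/\ path adjacent C s, {subset C :: s <= Cs} & last C s = D].

Lemma connected_in_cons C D Cs : connected_in Cs -> D \in Cs -> adjacent D C ->
  connected_in (C :: Cs).
Proof.
move=> conn DCs DC A B; rewrite !inE => /predU1P[->|ACs] /predU1P[->|BCs].
- by exists [::]; split=> // X; rewrite !inE orbF => ->.
- have [s [ps sCs sB]] := conn _ _ DCs BCs.
  exists (D :: s); split=> //=; first by rewrite adjacent_sym DC.
  move=> X; rewrite inE => /predU1P[->|/sCs XCs]; first exact: mem_head.
  by rewrite inE XCs orbT.
- have [s [ps sCs sD]] := conn _ _ ACs DCs.
  exists (rcons s C); rewrite rcons_path ps sD DC last_rcons; split=> // X.
  rewrite -rcons_cons mem_rcons inE => /predU1P[->|/sCs XCs]; first exact: mem_head.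
  by rewrite inE XCs orbT.
have [s [ps sCs sB]] := conn _ _ ACs BCs.
by exists s; split=> // X /sCs XCs; rewrite inE XCs orbT.
Qed.

(** Two neighbours of [C], joined inside [Cs], would close up to a cycle through [C]. *)
Lemma unique_neighbour Cs C D X : {subset Cs <= P} -> connected_in Cs ->
  C \in P -> C \notin Cs -> D \in Cs -> X \in Cs -> adjacent D C -> adjacent C X -> X = D.
Proof.
move=> CsP conn CP nC DCs XCs DC CX; apply: contrapT => nXD.
have [s [ps sCs sD]] := conn _ _ XCs DCs.
apply: (no_cycle simpleP thinP CX DC nXD ps sD _ CP).
  by move=> A /sCs/CsP.
by apply: contra nC => /sCs.
Qed.

(* A vertex of [C] away from [D] lying on a cell [X] of [Cs] would put [C] on a
   closed walk through [D], [X] and a common neighbour of [C] and [X]. *)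
Lemma new_vertex Cs C D p : {subset Cs <= P} -> connected_in Cs ->
  C \in P -> C \notin Cs -> D \in Cs -> adjacent D C -> p \in cell_vertices C ->
  p \notin cell_vertices D -> forall X, X \in Cs -> p \notin cell_vertices X.
Proof.
move=> CsP conn CP nC DCs DC pC pD X XCs; apply/negP => pX.
have nCX : C != X by apply: contraNneq nC => ->.
have [CX|[W [WP CW WX pW]]] := corner_cells CP (CsP _ XCs) nCX pC pX.
  by rewrite -(unique_neighbour CsP conn CP nC DCs XCs DC CX) pX in pD.
have nWD : W <> D by move=> e; rewrite -e pW in pD.
have nWC : W != C by apply: contraTneq CW => ->; rewrite /adjacent !(ltn_eqF (ltnSn _)) !andbF.
have [s [ps sCs sD]] := conn _ _ XCs DCs.
apply: (@no_cycle P simpleP C W D (X :: s)) => //=.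
- by rewrite WX.
- by move=> A; rewrite inE => /predU1P[->//|/sCs/CsP].
by rewrite inE eq_sym (negPf nWC) /=; apply: contra nC => /sCs.
Qed.

Section Extension.

Variables (b0 : bool) (x0 y0 : nat) (o0 : bool).

Local Notation built := (built b0 x0 y0 o0).

(** By [built_point_cell], only the ends of the starting edge could be points of [V] on no cell. The
    cell [C0] covers them, so being on no earlier cell, as given by [new_vertex], implies being
    fresh. *)
Lemma extend_built Cs V E R G C D (e0 := oriented_edge b0 x0 y0 o0) : built Cs V E R G ->
  (exists C0, [/\ C0 \in Cs, e0.1 \in cell_vertices C0 & e0.2 \in cell_vertices C0]) ->
  {subset Cs <= P} -> connected_in Cs -> C \in P -> C \notin Cs -> D \in Cs -> adjacent D C ->
  exists V' E' R' G', built (C :: Cs) V' E' R' G'.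
Proof.
move=> bt [C0 [C0Cs e1C0 e2C0]] CsP conn CP nC DCs DC.
have inV p : p \in V -> exists2 X, X \in Cs & p \in cell_vertices X.
  move=> /(built_point_cell bt)[//|]; rewrite !inE => /orP[] /eqP ->; by exists C0.
(* The side of [C] on which [D] lies is given by [r]; [r0] keeps [z.-1] from being truncated at
   0. *)
have [b [z [y [r [Ce De r0]]]]] : exists b z y (r : bool),
    [/\ C = frame b (z, y), D = frame b (if r then z.+1 else z.-1, y) & r || (0 < z)].
  case/adjacentP: DC => ->.
  - by exists false, D.1.+1, D.2, false; split=> //=; exact: surjective_pairing.
  - by exists false, C.1, C.2, true; split=> //=; exact: surjective_pairing.
  - by exists true, D.2.+1, D.1, false; split=> //=; exact: surjective_pairing.
  by exists true, C.2, C.1, true; split=> //=; exact: surjective_pairing.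
have [S [o SE]] : exists S o, (S, oriented_edge b (z + r) y o) \in E.
  have single w : frame b (w, y) = D ->
      exists S o, (S, oriented_edge b w y o) \in E /\ (S, oriented_edge b w.+1 y o) \in E.
    move=> wD; apply: (built_interval bt) => // v vw.
    by have -> : v = w; [move: vw; clear; lia|rewrite wD].
  case: r De r0 => /= De r0; have [S [o [SE SE']]] := single _ (esym De); exists S, o.
    by rewrite addn1.
  by rewrite addn0; move: SE'; rewrite prednK.
have fresh (i : bool) : frame b (z + ~~ r, y + i) \notin V.
  apply/negP => /inV[X XCs]; apply/negP.
  apply: (new_vertex CsP conn CP nC DCs DC) XCs; first by rewrite Ce frame_vertex.
  by rewrite De mem_frame mem_cell_vertices /=; move: r0; clear; case: (r) => /=; lia.
rewrite Ce.
do 4 eexists; apply: (built_cell (r := r) (o := o) bt SE); rewrite -?Ce //.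
- by move=> X XCs CX; rewrite -De; apply: (unique_neighbour CsP conn CP nC DCs XCs DC CX).
- exact: fresh.
exact: fresh.
Qed.

End Extension.

(** The starting edge is the left side of (i, j), its abscissa written [i + false] to match the form
    [z + r] in [built_cell]. *)
Lemma exists_built i j : (i, j) \in P ->
  exists Cs V E R G, built false (i + false) j false Cs V E R G /\ Cs =i P.
Proof.
move=> P0; set bt := built _ _ _ _.
have grow k : k < #|` P| -> exists Cs V E R G,
    [/\ bt Cs V E R G, size Cs = k.+1, (i, j) \in Cs, {subset Cs <= P} & connected_in Cs].
  elim: k => [_|k IH kP].
    pose e := oriented_edge false (i + false) j false.
    have b1 := built_edge false (i + false) j false.
    have /(built_cell (b := false) (z := i) (y := j) (r := false) (o := false) b1) b2 :
      (e.1, e) \in [:: (e.1, e)] by apply: mem_head.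
    exists [:: (i, j)]; do 4 eexists; split.
    + by apply: b2 => //; rewrite !inE /oriented_edge /= !xpair_eqE; lia.
    + by [].
    + exact: mem_head.
    + by move=> C; rewrite inE => /eqP->.
    move=> C D; rewrite !inE => /eqP-> /eqP->.
    by exists [::]; split.
  have [Cs [V [E [R [G [btCs sCs C0 CsP conn]]]]]] := IH (ltnW kP).
  have [uCs _] := built_uniq btCs.
  have [C1 C1P nC1] : exists2 C, C \in P & C \notin Cs.
    apply: contrapT => /forall2NP no; move: kP; rewrite -sCs ltnNge => /negP; apply.
    apply: uniq_leq_size => [|C CP]; first exact: fset_uniq.
    by case: (no C) => // /negP/negPn.
  (* The first step out of [Cs] on a path in [P] towards the missing cell. *)
  have [D [C [DCs DC CP nC]]] : exists D C, [/\ D \in Cs, adjacent D C, C \in P & C \notin Cs].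
    have [s [ps sP sC1]] := edge_connectedW connectedP (CsP _ C0) C1P.
    elim: s (i, j) C0 ps sP sC1 => [|A s IHs] D DCs /=.
      by move=> _ _ e; rewrite -e DCs in nC1.
    move=> /andP[DA ps] /andP[AP sP] sC1.
    have [ACs|nA] := boolP (A \in Cs); last by exists D, A.
    exact: IHs ACs ps sP sC1.
  have [V' [E' [R' [G' bt']]]] : exists V' E' R' G', bt (C :: Cs) V' E' R' G'.
    apply: (extend_built btCs) DC => //; exists (i, j).
    by rewrite !mem_cell_vertices /=; split=> //; lia.
  exists (C :: Cs), V', E', R', G'; split=> //=; first by rewrite sCs.
  + by rewrite inE C0 orbT.
  + by move=> A; rewrite inE => /predU1P[->|/CsP].
  exact: connected_in_cons conn DCs DC.
have P_gt0 : 0 < #|` P| by rewrite cardfs_gt0; apply/fset0Pn; exists (i, j).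
have [|Cs [V [E [R [G [btCs sCs _ CsP _]]]]]] := grow #|` P|.-1; first by rewrite prednK.
exists Cs, V, E, R, G; split=> // C; apply/idP/idP; first exact: CsP.
have [uCs _] := built_uniq btCs.
have [|_ ->] // := uniq_min_size uCs CsP.
by rewrite sCs prednK.
Qed.

End Existence.

(** * The Hilbert series *)

Lemma built_shape b0 x0 y0 o0 Cs V E R G L e : built b0 x0 y0 o0 Cs V E R G ->
  (L, e) \in E -> exists b x y o, e = oriented_edge b x y o.
Proof.
move=> bt; elim: bt L e => [f|{}Cs {}V {}E {}R {}G S b z y r o f f' _ IH _ _ _ _ _] L e.
  by rewrite inE => /eqP/(congr1 snd) /= ->; exists b0, x0, y0, o0.
case/attach_built_edgesP=> [[_ ->]|[i [_ ->]]|/IH //].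
  by exists b, (z + ~~ r), y, o.
by exists (~~ b), (y + i), z, (~~ r).
Qed.

Lemma matching_count0 (T : eqType) (G : seq (T * T)) A : matching_count G A 0 = 1.
Proof. by elim: G A => //= e G IH A; rewrite IH if_same addn0. Qed.

Lemma matching_count_large (T : eqType) (G : seq (T * T)) A k :
  size G < k -> matching_count G A k = 0.
Proof.
elim: G A k => [|e G IH] A [|k] //= Gk.
by rewrite !IH ?if_same // ltnW.
Qed.

Section BuiltAlgebra.

Variables (K : fieldType) (P : {fset cell}) (thinP : is_thin P).
Variables (b0 : bool) (x0 y0 : nat) (o0 : bool).
Variables (Cs : seq cell) (V : seq point) (E : seq (point * (point * point))).
Variables (R : seq ((point * point) * (point * point))) (G : seq (point * point)).
Hypotheses (bt : built b0 x0 y0 o0 Cs V E R G) (CsP : Cs =i P).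
Hypothesis VP : V =i vertices P.
Variable v0 : vertices P.

(** Points that are not vertices get the index of [v0]; the injectivity required of [idx] concerns
    [V] only, which has the same elements as [vertices P]. *)
Let idx (p : point) : 'I_#|{: vertices P}| := enum_rank (insubd v0 p).

Let idx_val (v : vertices P) : idx (val v) = enum_rank v.
Proof. by rewrite /idx valKd. Qed.

Local Notation x_ p := ('X_(idx p) : polyomino_ring K P)%R.

Lemma strip_binomialE b x x' y o :
  let f := (x_ (frame b (x, y)) * x_ (frame b (x', y.+1))
            - x_ (frame b (x, y.+1)) * x_ (frame b (x', y)))%R in
  strip_binomial K idx (oriented_edge b x y o) (oriented_edge b x' y o) =
    if o then (- f)%R else f.
Proof.
rewrite /strip_binomial; case: o; rewrite /= ?addn0 ?addn1; last first.
  by congr (_ - _)%R; apply: mulrC.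
by rewrite opprB; congr (_ - _)%R; apply: mulrC.
Qed.

Lemma strip_binomialC e e' :
  strip_binomial K idx e' e = (- strip_binomial K idx e e' :> polyomino_ring K P)%R.
Proof. by rewrite /strip_binomial opprB. Qed.

(** An inner interval at least two cells wide and two high would contain a square tetromino. So it
    is a run of cells in a row or a column, and its binomial is that of the two end edges, up to
    orientation. *)
Lemma built_binomial_strip f : @polyomino_binomial K P f ->
  exists S e e', [/\ (S, e) \in E, (S, e') \in E & f = strip_binomial K idx e e'].
Proof.
case=> [a [b [c [d [[ab1 ab2 inP] cE dE ->]]]]].
rewrite -!idx_val cE dE.
case: (val a) (val b) ab1 ab2 inP => [i j] [k l] /= ik jl inP.
have orient c' x x' y : x < x' -> (forall z, x <= z < x' -> frame c' (z, y) \in P) ->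
    exists S e e', [/\ (S, e) \in E, (S, e') \in E &
      (x_ (frame c' (x, y)) * x_ (frame c' (x', y.+1))
       - x_ (frame c' (x, y.+1)) * x_ (frame c' (x', y)))%R = strip_binomial K idx e e'].
  move=> xx' btw.
  have [||S [o [SE SE']]] := built_interval (b := c') (x := x) (x' := x') (y := y) bt.
  - by [].
  - by move=> z zP; rewrite CsP; apply: btw.
  have := strip_binomialE c' x x' y o; case: o SE SE' => SE SE' e.
    by exists S, (oriented_edge c' x' y true), (oriented_edge c' x y true);
      rewrite strip_binomialC e opprK.
  by exists S, (oriented_edge c' x y false), (oriented_edge c' x' y false).
have [ln|ln] := eqVneq l j.+1.
  by rewrite ln; apply: (orient false) => // z zP; apply: inP => //; rewrite ln; clear; lia.
have kn : k = i.+1.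
  by apply/eqP/negPn/negP => kn; have := thinP i j; rewrite !inP //=;
    move: ik jl kn ln; clear; lia.
have := orient true j l i jl; rewrite /= kn => H.
have [|S [e [e' [SE SE' fE]]]] := H.
  by move=> z zP; apply: inP => //; rewrite kn; clear; lia.
exists S, e, e'; split=> //; rewrite -fE; congr (_ - _)%R; apply: mulrC.
Qed.

Lemma square_ideal b x x' y : x < x' -> (forall z, x <= z < x' -> frame b (z, y) \in P) ->
  (forall i j : bool, frame b (if i then x' else x, y + j) \in V) ->
  (x_ (frame b (x, y)) * x_ (frame b (x', y.+1))
   - x_ (frame b (x, y.+1)) * x_ (frame b (x', y)))%R \in @polyomino_ideal K P.
Proof.
move=> xx' btw cV.
have vtx p : p \in V -> exists v : vertices P, val v = p.
  by rewrite VP => pP; exists [` pP]%fset.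
have [v00 e00] := vtx _ (cV false false); have [v01 e01] := vtx _ (cV false true).
have [v10 e10] := vtx _ (cV true false); have [v11 e11] := vtx _ (cV true true).
rewrite addn0 in e00 e10; rewrite addn1 in e01 e11.
rewrite -e00 -e01 -e10 -e11 !idx_val.
apply/asboolP.
exists [:: (1%R, ('X_(enum_rank v00) * 'X_(enum_rank v11)
                  - 'X_(enum_rank v01) * 'X_(enum_rank v10))%R)].
split; last by rewrite big_seq1 mul1r.
move=> q; rewrite inE => /eqP-> /=.
case: b btw cV e00 e01 e10 e11 => /= btw cV e00 e01 e10 e11.
  exists v00, v11, v10, v01; rewrite /= e00 e01 e10 e11; split=> //=;
    last by rewrite [X in (_ - X)%R]mulrC.
  split=> //= r s rP sP; have -> : r = y by move: rP; clear; lia.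
  exact: btw.
exists v00, v11, v01, v10; rewrite /= e00 e01 e10 e11; split=> //=.
split=> //= r s rP sP; have -> : s = y by move: sP; clear; lia.
exact: btw.
Qed.

Lemma built_strip_ideal S e e' : (S, e) \in E -> (S, e') \in E ->
  strip_binomial K idx e e' \in @polyomino_ideal K P.
Proof.
move=> SE SE'.
have [b [x [y [o eE]]]] := built_shape bt SE; have [b' [x' [y' [o' eE']]]] := built_shape bt SE'.
rewrite {}eE {}eE' in SE SE' *.
have [eb ey eo btw] := built_aligned bt SE SE'; subst b' y' o'.
have gr := built_grown bt.
have ends z : (S, oriented_edge b z y o) \in E -> forall j : bool, frame b (z, y + j) \in V.
  move=> /(grown_mem gr)[_ V1 V2] j; have [->|jo] := eqVneq j o; first exact: V1.
  by have -> : j = ~~ o by case: (j) (o) jo => -[].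
wlog ltx : x x' SE SE' btw / x < x' => [hwlog|].
  case: (ltngtP x x') => [lt|lt|->]; first exact: hwlog.
    rewrite strip_binomialC -mulN1r idealMr //; apply: hwlog => //.
    by rewrite minnC maxnC.
  by rewrite /strip_binomial subrr idealr0.
have /= fI : (x_ (frame b (x, y)) * x_ (frame b (x', y.+1))
    - x_ (frame b (x, y.+1)) * x_ (frame b (x', y)))%R \in @polyomino_ideal K P.
  apply: (square_ideal ltx) => [z zP|[] j].
  - by rewrite -CsP; apply: btw; move: zP ltx; clear; lia.
  - exact: ends SE' j.
  exact: ends SE j.
rewrite strip_binomialE; case: (o) => //.
by have := idealMr (-1)%R fI; rewrite mulN1r.
Qed.

Lemma built_hilbert_function k :
  hilbert_function K P k = multiset_count (forbids R) V xpred0 k.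
Proof.
have valV p : p \in V -> val (insubd v0 p) = p by rewrite VP => pP; apply: insubdK.
apply: (grown_hilbert_function (built_grown bt) _ _ built_binomial_strip built_strip_ideal).
- by move=> p q /valV ep /valV eq /enum_rank_inj e; rewrite -ep e eq.
move=> i; exists (val (enum_val i)); last by rewrite idx_val enum_valK.
by rewrite VP; apply: valP.
Qed.

(** One strip from the starting edge and one per cell make [size G + 1] strips; [grown_count] with
    nothing avoided adds one to this exponent. *)
Lemma built_hilbert_series :
  iter (size G + 2) diff (fun k => Posz (hilbert_function K P k))
  = (fun k => Posz (rook_count P k)).
Proof.
have gr := built_grown bt.
have sizeL : (count (predC xpred0) (strip_labels E)).+1 = size G + 2.
  rewrite addn2; congr _.+1; rewrite (@eq_count _ _ predT) // count_predT.
  elim: gr => [a b _|V' E' R' G' S a b c d gr' IH SE cV _ _] //.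
  by rewrite (strip_labels_attach d gr' SE cV) /= IH.
have -> : (fun k => Posz (rook_count P k)) = (fun k => Posz (matching_count G xpred0 k)).
  by apply/funext => k; rewrite (built_rook_count _ bt CsP).
rewrite -(grown_count xpred0 gr) -sizeL; congr (iter _ _ _); apply/funext => k.
rewrite built_hilbert_function; congr Posz; apply: eq_multiset_count => // v _.
by apply/esym/negP => /good_pointsP[L [o []]].
Qed.

End BuiltAlgebra.

(** The polynomial is cut at [rook_number], a maximum over k at most |P|; as the counts vanish
    beyond |P|, no nonzero one is lost. *)
Lemma rook_polynomial_coef (P : {fset cell}) k :
  (forall j, #|` P| < j -> rook_count P j = 0) ->
  ((rook_polynomial P)`_k)%R = Posz (rook_count P k).
Proof.
move=> large; rewrite coef_poly ltnS; case: leqP => // lt_k.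
congr Posz; apply/esym/eqP/negPn/negP => nz.
have kP : k < #|` P|.+1 by rewrite ltnS leqNgt; apply: contra nz => /large ->.
move: lt_k; rewrite ltnNge => /negP; apply.
exact: (bigmax_sup (Ordinal kP)).
Qed.

(** The value at 1 is a sum of nonnegative counts, the first of which is 1. *)
Lemma rook_polynomial_at1 (P : {fset cell}) :
  rook_count P 0 = 1 -> ((rook_polynomial P).[1] != 0)%R.
Proof.
move=> r0; rewrite horner_poly big_ord_recl expr1n mulr1 /= r0 lt0r_neq0 //.
by rewrite ltr_pwDl // sumr_ge0 // => i _; rewrite expr1n mulr1.
Qed.

Theorem theorem1p1 (K : fieldType) (P : {fset cell}) (h : {poly int}) (d : nat)
    (polyominoP : is_polyomino P) (simpleP : is_simple P) (thinP : is_thin P)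
    (hilbertP : is_reduced_hilbert_series K P h d) :
  h = rook_polynomial P.
Proof.
have [/fset0Pn[[i j] P0] connectedP] := polyominoP.
have [hs h1 _] := hilbertP.
have [Cs [V [E [R [G [bt CsP]]]]]] := exists_built simpleP thinP connectedP P0.
have memP p : reflect (exists2 C, C \in P & p \in cell_vertices C) (p \in vertices P).
  apply: (iffP (bigfcupP _ _ _ _)) => [[C /andP[CP _] pC]|[C CP pC]]; exists C => //.
  by rewrite CP.
have VP : V =i vertices P.
  move=> p; apply/idP/memP => [/(built_point_cell bt)[[C CC pC]|pe]|[C CP pC]].
  - by exists C; rewrite // -CsP.
  - exists (i, j) => //; rewrite mem_cell_vertices; move: pe; rewrite !inE.
    by case/orP=> /eqP -> /=; clear; lia.
  by apply: built_cell_vertices bt _ pC; rewrite CsP.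
have v0P : (i, j) \in vertices P.
  by apply/memP; exists (i, j) => //; rewrite mem_cell_vertices /=; clear; lia.
have rookE k := built_rook_count k bt CsP.
have [uCs sCs] := built_uniq bt.
have large k : #|` P| < k -> rook_count P k = 0.
  move=> Pk; rewrite rookE matching_count_large // -sCs.
  by apply: leq_ltn_trans Pk; apply: uniq_leq_size => // C; rewrite CsP.
apply: (@hilbert_numerator_unique (fun k => Posz (hilbert_function K P k)) _ _ d (size G + 2)).
- by [].
- by apply: rook_polynomial_at1; rewrite rookE matching_count0.
- by move=> k; rewrite -sum_one_subX_expr; apply: hs.
move=> k; rewrite (built_hilbert_series K thinP bt CsP VP [` v0P]%fset).
by rewrite rook_polynomial_coef.
Qed.
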